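(* (1) The function $h_1(r)=r\mathcal{K}(r)/\operatorname{arth} r$ is strictly decreasing and concave from $(0,1)$ onto $(1,\pi/2)$. (2) For each $n\in\mathbb{N}$, define the function $h_2$ on $(0,1)$ by $$h_2(r)=\frac{1}{r^{2(n+1)}}\left[\frac{3\operatorname{arth} r}{4r}-\frac{2}{\pi}\mathcal{K}(r)-\sum_{k=0}^n\tilde{a}_k r^{2k}\right].$$ Then the coefficients of the Maclaurin series of $h_2$ (in powers of $r^2$) are all positive. In particular, $h_2$ is strictly absolutely monotone on $(0,1)$, namely, $h_2^{(k)}(r)>0$ for all $k\in\mathbb{N}_0$ and $r\in(0,1)$, with $h_2(0^+)=\tilde{a}_{n+1}>0$ and $h_2(1^-)=\infty$. (3) For each $n\in\mathbb{N}$, with $h_2$ as in (2), the function $h_3(r)=rh_2(r)/\operatorname{arth} r$ is strictly increasing from $(0,1)$ onto $(\tilde{a}_{n+1},\,3/4-2/\pi)$. (4) The function $$h_4(r)=\frac{1}{r^6}\left[\frac{\pi}{2}\left(1-\frac{1}{12}r^2-\frac{91}{2880}r^4\right)-\frac{r\mathcal{K}(r)}{\operatorname{arth} r}\right]$$ is strictly increasing from $(0,1)$ onto $(871\pi/96768,\,2549\pi/5760-1)$. (5) For each $n\in\mathbb{N}$ and all $r\in(0,1)$, $$\frac14+\frac{3\operatorname{arth} r}{4r}-\sum_{k=2}^{n+1}\tilde{a}_kr^{2k}-P_1(r)r^{2n+2}<\frac{2}{\pi}\mathcal{K}(r)<\frac14+\frac{3\operatorname{arth} r}{4r}-\sum_{k=2}^{n+1}\tilde{a}_kr^{2k}-P_2(r)r^{2n+2},\quad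 (\mathrm{i})$$ $$\left[P_3(r)-\alpha r^6\right]\frac{\operatorname{arth} r}{r}<\frac{2}{\pi}\mathcal{K}(r)<\left[P_3(r)-\beta r^6\right]\frac{\operatorname{arth} r}{r},\quad (\mathrm{ii})$$ $$\frac14+\frac34\left(1-\delta r^4\right)\frac{\operatorname{arth} r}{r}<\frac{2}{\pi}\mathcal{K}(r)<\frac14+\frac34\left(1-\eta r^4\right)\frac{\operatorname{arth} r}{r},\quad (\mathrm{iii})$$ where $$P_1(r)=\frac{3\pi-8}{4\pi}\frac{\operatorname{arth} r}{r}-\tilde{a}_{n+1},\qquad P_2(r)=\tilde{a}_{n+1}\left(\frac{\operatorname{arth} r}{r}-1\right),\qquad P_3(r)=1-\frac{1}{12}r^2-\frac{91}{2880}r^4,$$ $\alpha=\frac{2549}{2880}-\frac{2}{\pi}$, $\beta=871/48384$, $\delta=1-8/(3\pi)$ and $\eta=1/80$. Moreover, the constants $\alpha,\beta,\delta,\eta$ in (ii) and (iii) are all best possible.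
   Context: $\mathbb{N}$ is the set of positive integers, $\mathbb{N}_0=\mathbb{N}\cup\{0\}$. $\operatorname{arth}$ denotes the inverse hyperbolic tangent. For $r\in(0,1)$, $\mathcal{K}(r)=\int_0^{\pi/2}(1-r^2\sin^2t)^{-1/2}\,dt$ is the complete elliptic integral of the first kind. For $n\in\mathbb{N}_0$, $a_n=\left[(1/2)_n/n!\right]^2$ and $\tilde{a}_n=\frac{3}{4(2n+1)}-a_n$, where $(a)_0=1$ and $(a)_n=a(a+1)\cdots(a+n-1)$. $h(0^+)$ and $h(1^-)$ denote one-sided limits. ''Best possible'' means that the corresponding inequality, required for all $r\in(0,1)$, fails if $\alpha$ or $\delta$ is replaced by a smaller constant, or if $\beta$ or $\eta$ is replaced by a larger constant. *)

(* Defs.v *)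
From Stdlib Require Import Reals Factorial Lra.
From Coquelicot Require Import Coquelicot.

Open Scope R_scope.

Definition arth (r : R) : R := / 2 * ln ((1 + r) / (1 - r)).

Lemma tanh_arth (r : R) : -1 < r < 1 -> tanh (arth r) = r.
Proof.
intros [Hm Hp].
assert (Hq : 0 < (1 + r) / (1 - r)) by (apply Rdiv_lt_0_compat; lra).
assert (Hs : exp (arth r) * exp (arth r) = (1 + r) / (1 - r)).
{ rewrite <- exp_plus.
  replace (arth r + arth r) with (ln ((1 + r) / (1 - r))) by (unfold arth; field).
  now apply exp_ln. }
assert (He := exp_pos (arth r)).
unfold tanh, sinh, cosh; rewrite exp_Ropp.
set (e := exp (arth r)) in *.
replace ((e - / e) / 2 / ((e + / e) / 2)) with ((e * e - 1) / (e * e + 1)).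
- rewrite Hs; field; lra.
- field; split; nra.
Qed.

Definition ellK (r : R) : R :=
  RInt (fun t : R => / sqrt (1 - r ^ 2 * sin t ^ 2)) 0 (PI / 2).

Fixpoint pochhammer (x : R) (n : nat) : R :=
  match n with
  | O => 1
  | S m => pochhammer x m * (x + INR m)
  end.

Definition acoef (n : nat) : R := (pochhammer (1 / 2) n / INR (fact n)) ^ 2.

Definition atilde (n : nat) : R := 3 / (4 * (2 * INR n + 1)) - acoef n.

Definition strictly_decreasing_01 (f : R -> R) : Prop :=
  forall x y : R, 0 < x -> x < y -> y < 1 -> f y < f x.

Definition strictly_increasing_01 (f : R -> R) : Prop :=
  forall x y : R, 0 < x -> x < y -> y < 1 -> f x < f y.

Definition concave_01 (f : R -> R) : Prop :=
  forall x y t : R, 0 < x < 1 -> 0 < y < 1 -> 0 <= t <= 1 ->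
    t * f x + (1 - t) * f y <= f (t * x + (1 - t) * y).

Definition maps_01_onto (f : R -> R) (a b : R) : Prop :=
  forall y : R, a < y < b <-> exists r : R, 0 < r < 1 /\ f r = y.

(* [Derive_n] is total, so the existence of every derivative is required
   separately. *)
Definition strictly_absolutely_monotone_01 (f : R -> R) : Prop :=
  forall (k : nat) (r : R), 0 < r < 1 ->
    ex_derive_n f k r /\ 0 < Derive_n f k r.

(* [c] is the coefficient sequence, in powers of r^2, of the Maclaurin series
   of [f].  The value [f 0] is not constrained: the functions below are given by
   quotients that are only meaningful on (0,1). *)
Definition is_maclaurin_sq_01 (f : R -> R) (c : nat -> R) : Prop :=
  forall r : R, 0 < r < 1 -> is_pseries c (r ^ 2) (f r).

Definition h1 (r : R) : R := r * ellK r / arth r.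

Definition h2 (n : nat) (r : R) : R :=
  1 / r ^ (2 * (n + 1)) *
  (3 * arth r / (4 * r) - 2 / PI * ellK r
   - sum_n_m (fun k : nat => atilde k * r ^ (2 * k)) 0 n).

Definition h3 (n : nat) (r : R) : R := r * h2 n r / arth r.

Definition h4 (r : R) : R :=
  1 / r ^ 6 *
  (PI / 2 * (1 - 1 / 12 * r ^ 2 - 91 / 2880 * r ^ 4) - r * ellK r / arth r).

Definition P1 (n : nat) (r : R) : R :=
  (3 * PI - 8) / (4 * PI) * (arth r / r) - atilde (n + 1).

Definition P2 (n : nat) (r : R) : R := atilde (n + 1) * (arth r / r - 1).

Definition P3 (r : R) : R := 1 - 1 / 12 * r ^ 2 - 91 / 2880 * r ^ 4.

Definition bound_i (n : nat) (P : R -> R) (r : R) : R :=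
  1 / 4 + 3 * arth r / (4 * r)
  - sum_n_m (fun k : nat => atilde k * r ^ (2 * k)) 2 (n + 1)
  - P r * r ^ (2 * n + 2).

Definition bound_ii (c r : R) : R := (P3 r - c * r ^ 6) * (arth r / r).

Definition bound_iii (c r : R) : R :=
  1 / 4 + 3 / 4 * (1 - c * r ^ 4) * (arth r / r).

Definition lower_bound_01 (g : R -> R) : Prop :=
  forall r : R, 0 < r < 1 -> g r < 2 / PI * ellK r.

Definition upper_bound_01 (g : R -> R) : Prop :=
  forall r : R, 0 < r < 1 -> 2 / PI * ellK r < g r.

Definition alpha : R := 2549 / 2880 - 2 / PI.
Definition beta : R := 871 / 48384.
Definition delta : R := 1 - 8 / (3 * PI).
Definition eta : R := 1 / 80.

(* Main.v *)
(* With x = r^2, arth r / r = sum x^n / (2n+1) and (2/pi) K(r) = sum a_n x^n.  The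
   coefficients b_n = 1 / (2n+1) of the first series are log-convex, so by Kaluza's
   argument a quotient (sum p_n x^n) / (sum b_n x^n) has positive coefficients as
   soon as p_0 > 0 and p_n / b_n increases.  Since a_n / b_n = (2n+1) a_n decreases,
   this applies to every tail p_k = kappa b_{m+k} - a_{m+k} whose first term is
   positive.  The case kappa = m = 1 gives h1 = (pi/2) (1 - x Q(x)) with Q positive,
   whence h1 and h4; the case kappa = 3/4, m = n+1 gives h3.  The behaviour at
   r = 1 comes from int_0^{pi/2} sin t / sqrt (1 - r^2 sin^2 t) dt = arth r / r, which
   yields 0 <= K(r) - arth r / r <= pi/2.  The inequalities (5) restate the ranges
   of h3 and h4. *)

Require Import Defs.
From Stdlib Require Import Reals Factorial Wf_nat Lra Lia.
From Coquelicot Require Import Coquelicot.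

Open Scope R_scope.

(** * Power series with positive coefficients *)

(** Kaluza's argument does more than fix signs. The quotient is never formed analytically: its
    coefficients q_n come from the recursion that inverts the Cauchy product, and since b_0 = 1 and
    every subtracted term is nonnegative, positivity gives q_n <= p_n. The numerators used have p_n
    <= kappa <= 1, so the quotient series converges for |x| < 1, and multiplying it back by arth r /
    r recovers the tail. The two values of kappa are those that cancel a coefficient. The ratio
    (2n+1) a_n equals 1 at n = 0 and 3/4 at n = 1. For kappa = 1 the constant coefficient of kappa
    b_n - a_n vanishes and all later ones are positive. For kappa = 3/4 the coefficients start with
    -1/4 and 0 and are positive exactly from index 2, which is why the tails start at n+1 with n >=
    1, and where the isolated 1/4 in (i) and (iii) comes from. Concavity of h1 also needs only
    signs: each r^(2k) is convex, and h1 is a constant minus a nonnegative combination of such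
    powers. *)

Lemma CV_radius_ge_1 (a : nat -> R) (M : R) :
  (forall n, Rabs (a n) <= M) -> Rbar_le 1 (CV_radius a).
Proof.
intros H.
apply (proj1 (CV_radius_bounded a)).
exists M; intros n; rewrite pow1, Rmult_1_r; apply H.
Qed.

Lemma Rabs_lt_CV_radius (a : nat -> R) (M x : R) :
  (forall n, Rabs (a n) <= M) -> Rabs x < 1 -> Rbar_lt (Rabs x) (CV_radius a).
Proof.
intros H Hx; apply Rbar_lt_le_trans with 1; [exact Hx | now apply CV_radius_ge_1 with M].
Qed.

Lemma is_pseries_of_bounded (a : nat -> R) (M x : R) :
  (forall n, Rabs (a n) <= M) -> Rabs x < 1 -> is_pseries a x (PSeries a x).
Proof.
intros H Hx; apply PSeries_correct, CV_radius_inside.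
now apply Rabs_lt_CV_radius with M.
Qed.

(** * Division of power series, coefficient by coefficient *)

(** Each coefficient depends on all earlier ones, whereas structural recursion gives access only to
    the predecessor. So the recursion builds the table of the coefficients of index at most [n];
    entries beyond [n] are meaningless. No division occurs because [b O] is meant to be 1. *)
Fixpoint quotient_coef_upto (p b : nat -> R) (n : nat) : nat -> R :=
  match n with
  | O => fun _ => p O
  | S m => fun k =>
      if Nat.leb k m then quotient_coef_upto p b m k
      else p (S m) - sum_f_R0 (fun j => quotient_coef_upto p b m j * b (S m - j)%nat) m
  end.

Definition quotient_coef (p b : nat -> R) (n : nat) : R :=
  quotient_coef_upto p b n n.

Lemma quotient_coef_upto_le (p b : nat -> R) (n k : nat) :
  (k <= n)%nat -> quotient_coef_upto p b n k = quotient_coef p b k.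
Proof.
induction n as [|n IH]; intros Hk.
- now replace k with O by lia.
- destruct (Nat.eq_dec k (S n)) as [->|Hne]; [reflexivity|].
  simpl; rewrite (proj2 (Nat.leb_le k n)) by lia; apply IH; lia.
Qed.

Lemma quotient_coef_0 (p b : nat -> R) : quotient_coef p b 0 = p O.
Proof. reflexivity. Qed.

Lemma quotient_coef_S (p b : nat -> R) (n : nat) :
  quotient_coef p b (S n) =
  p (S n) - sum_f_R0 (fun k => quotient_coef p b k * b (S n - k)%nat) n.
Proof.
unfold quotient_coef at 1; cbn [quotient_coef_upto].
rewrite (proj2 (Nat.leb_gt (S n) n)) by lia.
f_equal; apply sum_eq; intros i Hi.
now rewrite quotient_coef_upto_le.
Qed.

Lemma PS_mult_quotient_coef (p b : nat -> R) :
  b O = 1 -> forall n, PS_mult (quotient_coef p b) b n = p n.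
Proof.
intros Hb [|n]; unfold PS_mult.
- simpl; rewrite Hb, quotient_coef_0; ring.
- cbn [sum_f_R0]; rewrite Nat.sub_diag, Hb, (quotient_coef_S p b n); ring.
Qed.

(* Kaluza's argument: [b (m+1) / b m <= b (n+1) / b n] for [m <= n] turns
   [p n = sum_k q k * b (n-k)] into [q (n+1) >= p (n+1) - b (n+1) / b n * p n]. *)
Lemma quotient_coef_pos (p b : nat -> R) :
  b O = 1 -> (forall n, 0 < b n) ->
  (forall m n, (m <= n)%nat -> b (S m) * b n <= b (S n) * b m) ->
  0 < p O -> (forall n, p n * b (S n) < p (S n) * b n) ->
  forall n, 0 < quotient_coef p b n <= p n.
Proof.
intros Hb0 Hb Hlc Hp0 Hp.
assert (Hpos : forall n, 0 < quotient_coef p b n).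
{ induction n as [n IH] using lt_wf_ind.
  destruct n as [|n]; [exact Hp0|].
  rewrite quotient_coef_S.
  assert (Hle : sum_f_R0 (fun k => quotient_coef p b k * b (S n - k)%nat) n
                <= b (S n) / b n * p n).
  { rewrite <- (PS_mult_quotient_coef p b Hb0 n); unfold PS_mult.
    rewrite scal_sum; apply sum_Rle; intros k Hk.
    rewrite Rmult_assoc; apply Rmult_le_compat_l; [left; apply IH; lia|].
    replace (S n - k)%nat with (S (n - k)) by lia.
    apply Rmult_le_reg_r with (b n); [apply Hb|].
    replace (b (n - k)%nat * (b (S n) / b n) * b n) with (b (S n) * b (n - k)%nat)
      by (field; apply Rgt_not_eq, Hb).
    apply Hlc; lia. }
  assert (H : b (S n) / b n * p n < p (S n)).
  { apply Rmult_lt_reg_r with (b n); [apply Hb|].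
    replace (b (S n) / b n * p n * b n) with (p n * b (S n))
      by (field; apply Rgt_not_eq, Hb).
    apply Hp. }
  lra. }
intros n; split; [apply Hpos|].
destruct n as [|n]; [rewrite quotient_coef_0; lra|].
rewrite quotient_coef_S.
assert (0 <= sum_f_R0 (fun k => quotient_coef p b k * b (S n - k)%nat) n); [|lra].
apply cond_pos_sum; intros k; left; apply Rmult_lt_0_compat; [apply Hpos|apply Hb].
Qed.

(** * Sign and monotonicity of sums of series *)

Lemma PSeries_split2 (a : nat -> R) (x : R) :
  ex_pseries a x ->
  ex_series (fun n => a (2 + n)%nat * x ^ (2 + n)) /\
  PSeries a x = a O + a 1%nat * x + Series (fun n => a (2 + n)%nat * x ^ (2 + n)).
Proof.
intros [l Hl].
assert (Hex : ex_series (fun n => a n * x ^ n)) by (exists l; now apply is_pseries_R).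
split; [exact (proj1 (ex_series_incr_n _ 2) Hex)|].
unfold PSeries; rewrite (Series_incr_n _ 2) by (trivial; lia).
simpl sum_f_R0; simpl (x ^ 0); simpl (x ^ 1); ring.
Qed.

(** The hypothesis bears on [a O + a 1] because the derivatives of an even series have zero
    coefficients at every other index: only one of the first two can be positive, and which one
    depends on the order of the derivative. *)
Lemma PSeries_gt_0 (a : nat -> R) (x : R) :
  (forall n, 0 <= a n) -> 0 < a O + a 1%nat -> 0 < x -> ex_pseries a x ->
  0 < PSeries a x.
Proof.
intros Ha Ha01 Hx Hex; destruct (PSeries_split2 a x Hex) as [Hs ->].
assert (0 <= Series (fun n => a (2 + n)%nat * x ^ (2 + n))).
{ replace 0 with (Series (fun k : nat => 0 * 0)) by (rewrite Series_scal_l; ring).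
  apply Series_le; trivial; intros n; split; [lra|].
  rewrite Rmult_0_l; apply Rmult_le_pos; [apply Ha|apply pow_le; lra]. }
assert (H0 := Ha 0%nat); assert (H1 := Ha 1%nat); destruct H0; nra.
Qed.

(** The linear term alone gives strictness, so the constant coefficient may vanish, as it does for
    the shifted series behind [h1]. *)
Lemma PSeries_lt (c : nat -> R) (M x y : R) :
  (forall n, 0 <= c n <= M) -> 0 < c 1%nat -> 0 <= x -> x < y -> y < 1 ->
  PSeries c x < PSeries c y.
Proof.
intros Hc Hc1 Hx Hxy Hy.
assert (Hb : forall n, Rabs (c n) <= M).
{ intros n; destruct (Hc n); rewrite Rabs_pos_eq; lra. }
assert (Hex : forall z, 0 <= z < 1 -> ex_pseries c z).
{ intros z Hz; exists (PSeries c z).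
  apply is_pseries_of_bounded with M; trivial; rewrite Rabs_pos_eq; lra. }
destruct (PSeries_split2 c x) as [_ ->]; [apply Hex; lra|].
destruct (PSeries_split2 c y) as [Hsy ->]; [apply Hex; lra|].
assert (Series (fun k => c (2 + k)%nat * x ^ (2 + k)) <=
        Series (fun k => c (2 + k)%nat * y ^ (2 + k))).
{ apply Series_le; trivial; intros n; destruct (Hc (2 + n)%nat); split.
  - apply Rmult_le_pos; [lra|now apply pow_le].
  - apply Rmult_le_compat_l; [lra|apply pow_incr; lra]. }
assert (c 1%nat * x < c 1%nat * y) by (apply Rmult_lt_compat_l; lra).
lra.
Qed.

Lemma Rabs_sqr_lt_1 (r : R) : -1 < r < 1 -> Rabs (r ^ 2) < 1.
Proof. intros H; rewrite Rabs_pos_eq; nra. Qed.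

Lemma continuity_pt_PSeries_sqr (c : nat -> R) (M r : R) :
  (forall n, Rabs (c n) <= M) -> -1 < r < 1 ->
  continuity_pt (fun r => PSeries c (r ^ 2)) r.
Proof.
intros Hc Hr.
apply (continuity_pt_comp (fun r => r ^ 2) (PSeries c)).
- apply derivable_continuous_pt, derivable_pt_pow.
- apply PSeries_continuity, Rabs_lt_CV_radius with M; trivial; now apply Rabs_sqr_lt_1.
Qed.

Lemma filterlim_at_right_0_PSeries_sqr (c : nat -> R) (M : R) :
  (forall n, Rabs (c n) <= M) ->
  filterlim (fun r => PSeries c (r ^ 2)) (at_right 0) (locally (c O)).
Proof.
intros Hc.
rewrite <- (PSeries_0 c); replace (PSeries c 0) with (PSeries c (0 ^ 2)) by (f_equal; ring).
intros P HP; apply filter_le_within.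
refine (proj1 (continuity_pt_filterlim (fun r => PSeries c (r ^ 2)) 0) _ P HP).
apply continuity_pt_PSeries_sqr with M; trivial; lra.
Qed.

(** * Ranges on (0,1) from one-sided limits *)

Lemma at_right_0_below (a : R) : 0 < a -> at_right 0 (fun r => 0 < r < a).
Proof.
intros Ha; exists (mkposreal a Ha); intros y Hy Hy0.
unfold ball in Hy; simpl in Hy; unfold AbsRing_ball, abs, minus, plus, opp in Hy; simpl in Hy.
apply Rabs_def2 in Hy; lra.
Qed.

Lemma at_left_1_above (a : R) : a < 1 -> at_left 1 (fun r => a < r < 1).
Proof.
intros Ha; assert (H : 0 < 1 - a) by lra.
exists (mkposreal (1 - a) H); intros y Hy Hy0.
unfold ball in Hy; simpl in Hy; unfold AbsRing_ball, abs, minus, plus, opp in Hy; simpl in Hy.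
apply Rabs_def2 in Hy; lra.
Qed.

Lemma maps_01_onto_of_lims (f : R -> R) (a b : R) :
  strictly_increasing_01 f ->
  (forall r, 0 < r < 1 -> continuity_pt f r) ->
  filterlim f (at_right 0) (locally a) ->
  filterlim f (at_left 1) (locally b) ->
  maps_01_onto f a b.
Proof.
intros Hf Hc Ha Hb y.
assert (near0 : forall e s, 0 < e -> 0 < s -> exists r, 0 < r < s /\ Rabs (f r - a) < e).
{ intros e s He Hs.
  assert (H : at_right 0 (fun r => 0 < r < s /\ Rabs (f r - a) < e)).
  { apply filter_and; [now apply at_right_0_below|].
    apply (Ha (fun z => Rabs (z - a) < e)); exists (mkposreal e He); intros z Hz; exact Hz. }
  destruct (filter_ex _ H) as [r Hr]; now exists r. }
assert (near1 : forall e s, 0 < e -> s < 1 -> exists r, s < r < 1 /\ Rabs (f r - b) < e).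
{ intros e s He Hs.
  assert (H : at_left 1 (fun r => s < r < 1 /\ Rabs (f r - b) < e)).
  { apply filter_and; [now apply at_left_1_above|].
    apply (Hb (fun z => Rabs (z - b) < e)); exists (mkposreal e He); intros z Hz; exact Hz. }
  destruct (filter_ex _ H) as [r Hr]; now exists r. }
(* Passing to the limit only gives [a <= f (r / 2)]; the intermediate point [r / 2] restores
   strictness. The bound by [b] uses the midpoint of [r] and 1 in the same way. *)
assert (Hgt : forall r, 0 < r < 1 -> a < f r).
{ intros r Hr; assert (Hm : f (r / 2) < f r) by (apply Hf; lra).
  destruct (near0 (f r - f (r / 2)) (r / 2)) as [s [Hs Hs']]; [lra|lra|].
  assert (f s < f (r / 2)) by (apply Hf; lra).
  apply Rabs_def2 in Hs'; lra. }
assert (Hlt : forall r, 0 < r < 1 -> f r < b).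
{ intros r Hr; assert (Hm : f r < f ((r + 1) / 2)) by (apply Hf; lra).
  destruct (near1 (f ((r + 1) / 2) - f r) ((r + 1) / 2)) as [s [Hs Hs']]; [lra|lra|].
  assert (f ((r + 1) / 2) < f s) by (apply Hf; lra).
  apply Rabs_def2 in Hs'; lra. }
split.
- intros Hy.
  destruct (near0 (y - a) 1) as [u [Hu Hu']]; [lra|lra|].
  destruct (near1 (b - y) u) as [v [Hv Hv']]; [lra|lra|].
  apply Rabs_def2 in Hu'; apply Rabs_def2 in Hv'.
  destruct (Ranalysis5.IVT_interv (fun r => f r - y) u v) as [z [Hz Hz']]; try lra.
  + intros r Hr; apply continuity_pt_minus; [apply Hc; lra|].
    apply continuity_pt_const; intros ? ?; reflexivity.
  + exists z; lra.
- intros [r [Hr <-]]; auto.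
Qed.

Lemma maps_01_onto_pseries (f : R -> R) (c : nat -> R) (M b : R) :
  (forall n, 0 <= c n <= M) -> 0 < c 1%nat ->
  (forall r, 0 < r < 1 -> f r = PSeries c (r ^ 2)) ->
  filterlim f (at_left 1) (locally b) ->
  strictly_increasing_01 f /\ maps_01_onto f (c O) b.
Proof.
intros Hc Hc1 Hf Hb.
assert (Hb' : forall n, Rabs (c n) <= M).
{ intros n; destruct (Hc n); rewrite Rabs_pos_eq; lra. }
assert (Hinc : strictly_increasing_01 f).
{ intros x y Hx Hxy Hy; rewrite !Hf by lra.
  apply PSeries_lt with M; trivial; nra. }
split; trivial.
apply maps_01_onto_of_lims; trivial.
- intros r Hr.
  apply continuity_pt_ext_loc with (fun r => PSeries c (r ^ 2)).
  + apply filter_imp with (fun r => 0 < r < 1); [intros y Hy; now rewrite Hf|].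
    apply (open_and _ _ (open_gt 0) (open_lt 1)); exact Hr.
  + apply continuity_pt_PSeries_sqr with M; trivial; lra.
- apply filterlim_ext_loc with (fun r => PSeries c (r ^ 2)).
  + apply filter_imp with (2 := at_right_0_below 1 Rlt_0_1); intros y Hy; now rewrite Hf.
  + now apply filterlim_at_right_0_PSeries_sqr with M.
Qed.

Lemma maps_01_onto_scal (f : R -> R) (a b k : R) :
  0 < k -> maps_01_onto f a b -> maps_01_onto (fun r => k * f r) (k * a) (k * b).
Proof.
intros Hk Hf y; split.
- intros Hy; assert (Hd : k * (y / k) = y) by (field; lra).
  destruct (proj1 (Hf (y / k))) as [r [Hr Hfr]].
  + split; apply Rmult_lt_reg_l with k; lra.
  + exists r; split; trivial; now rewrite Hfr.
- intros [r [Hr <-]].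
  assert (H : a < f r < b) by (apply Hf; now exists r).
  split; apply Rmult_lt_compat_l; lra.
Qed.

Lemma maps_01_onto_reflect (f : R -> R) (a b c : R) :
  maps_01_onto f a b -> maps_01_onto (fun r => c - f r) (c - b) (c - a).
Proof.
intros Hf y; split.
- intros Hy; destruct (proj1 (Hf (c - y))) as [r [Hr Hfr]]; [lra|].
  exists r; split; trivial; lra.
- intros [r [Hr <-]].
  assert (H : a < f r < b) by (apply Hf; now exists r); lra.
Qed.

Lemma maps_01_onto_ext (f g : R -> R) (a b : R) :
  (forall r, 0 < r < 1 -> g r = f r) -> maps_01_onto f a b -> maps_01_onto g a b.
Proof.
intros Heq Hf y; split.
- intros Hy; destruct (proj1 (Hf y) Hy) as [r [Hr Hfr]].
  exists r; split; trivial; now rewrite Heq.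
- intros [r [Hr Hgr]]; apply Hf; exists r; split; trivial; now rewrite <- Heq.
Qed.

Lemma maps_01_onto_bounds (f : R -> R) (a b r : R) :
  maps_01_onto f a b -> 0 < r < 1 -> a < f r < b.
Proof. intros Hf Hr; apply Hf; now exists r. Qed.

Lemma maps_01_onto_above (f : R -> R) (a b c : R) :
  maps_01_onto f a b -> c < b -> exists r, 0 < r < 1 /\ c < f r.
Proof.
intros Hf Hc.
(* The value at the sample point [/ 2] shows [a < b]. As [c] may lie below [a], the value to be
   attained is the midpoint of [Rmax a c] and [b]. *)
assert (Hab := maps_01_onto_bounds f a b (/ 2) Hf ltac:(lra)).
assert (H1 := Rmax_l a c); assert (H2 := Rmax_r a c).
assert (H3 : Rmax a c < b) by (apply Rmax_lub_lt; lra).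
destruct (proj1 (Hf ((Rmax a c + b) / 2))) as [r [Hr Hfr]]; [lra|].
exists r; split; trivial; lra.
Qed.

Lemma maps_01_onto_below (f : R -> R) (a b c : R) :
  maps_01_onto f a b -> a < c -> exists r, 0 < r < 1 /\ f r < c.
Proof.
intros Hf Hc.
assert (Hab := maps_01_onto_bounds f a b (/ 2) Hf ltac:(lra)).
assert (H1 := Rmin_l b c); assert (H2 := Rmin_r b c).
assert (H3 : a < Rmin b c) by (apply Rmin_glb_lt; lra).
destruct (proj1 (Hf ((a + Rmin b c) / 2))) as [r [Hr Hfr]]; [lra|].
exists r; split; trivial; lra.
Qed.

(** * Convexity and absolute monotonicity of series in r^2 *)

(** In the induction step the gap between the target and the product of the two convex combinations
    is t (1-t) (x-y) (x^n - y^n), whose last two factors have the same sign. *)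
Lemma pow_convex (n : nat) (x y t : R) :
  0 <= x -> 0 <= y -> 0 <= t <= 1 ->
  (t * x + (1 - t) * y) ^ n <= t * x ^ n + (1 - t) * y ^ n.
Proof.
intros Hx Hy Ht; induction n as [|n IH]; [simpl; lra|].
assert (Hz : 0 <= t * x + (1 - t) * y).
{ apply Rplus_le_le_0_compat; apply Rmult_le_pos; lra. }
cbn [pow].
apply Rle_trans with ((t * x + (1 - t) * y) * (t * x ^ n + (1 - t) * y ^ n)).
{ now apply Rmult_le_compat_l. }
assert (H : 0 <= (x - y) * (x ^ n - y ^ n)).
{ destruct (Rle_dec x y) as [Hxy|Hxy].
  - assert (x ^ n <= y ^ n) by (apply pow_incr; lra); nra.
  - assert (y ^ n <= x ^ n) by (apply pow_incr; lra); nra. }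
assert (H' : 0 <= t * (1 - t) * ((x - y) * (x ^ n - y ^ n))).
{ apply Rmult_le_pos; trivial; apply Rmult_le_pos; lra. }
lra.
Qed.

Lemma PSeries_sqr_convex (c : nat -> R) (M x y t : R) :
  (forall n, 0 <= c n <= M) -> 0 < x < 1 -> 0 < y < 1 -> 0 <= t <= 1 ->
  PSeries c ((t * x + (1 - t) * y) ^ 2) <=
  t * PSeries c (x ^ 2) + (1 - t) * PSeries c (y ^ 2).
Proof.
intros Hc Hx Hy Ht.
assert (Hb : forall n, Rabs (c n) <= M).
{ intros n; destruct (Hc n); rewrite Rabs_pos_eq; lra. }
assert (Hex : forall z, 0 < z < 1 -> ex_series (fun n => c n * (z ^ 2) ^ n)).
{ intros z Hz; exists (PSeries c (z ^ 2)); apply is_pseries_R.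
  apply is_pseries_of_bounded with M; trivial; apply Rabs_sqr_lt_1; lra. }
assert (Hexs : forall k z, 0 < z < 1 -> ex_series (fun n => k * (c n * (z ^ 2) ^ n))).
{ intros k z Hz; exact (ex_series_scal k _ (Hex z Hz)). }
unfold PSeries; rewrite <- !Series_scal_l, <- Series_plus by now apply Hexs.
apply Series_le.
- intros n; rewrite <- !pow_mult; destruct (Hc n) as [Hn _]; split.
  + apply Rmult_le_pos; trivial; apply pow_le.
    apply Rplus_le_le_0_compat; apply Rmult_le_pos; lra.
  + replace (t * (c n * x ^ (2 * n)) + (1 - t) * (c n * y ^ (2 * n))) with
      (c n * (t * x ^ (2 * n) + (1 - t) * y ^ (2 * n))) by ring.
    apply Rmult_le_compat_l; trivial; apply pow_convex; lra.
- apply (ex_series_plus (fun n => t * (c n * (x ^ 2) ^ n))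
           (fun n => (1 - t) * (c n * (y ^ 2) ^ n))); now apply Hexs.
Qed.

(** A series in [r ^ 2] rewritten as a series in [r], because absolute monotonicity differentiates
    with respect to [r]. *)
Definition even_coef (c : nat -> R) (n : nat) : R :=
  if Nat.even n then c (Nat.div2 n) else 0.

Lemma even_coef_even (c : nat -> R) (n : nat) : even_coef c (2 * n) = c n.
Proof. unfold even_coef; now rewrite Nat.even_even, Nat.div2_double. Qed.

Lemma even_coef_odd (c : nat -> R) (n : nat) : even_coef c (2 * n + 1) = 0.
Proof. unfold even_coef; now rewrite Nat.even_odd. Qed.

Lemma strictly_absolutely_monotone_pseries (f : R -> R) (c : nat -> R) (M : R) :
  (forall n, 0 < c n <= M) -> is_maclaurin_sq_01 f c ->
  strictly_absolutely_monotone_01 f.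
Proof.
intros Hc Hf k r Hr.
set (p := even_coef c).
assert (Hp : forall n, 0 <= p n).
{ intros n; unfold p, even_coef; destruct (Nat.even n); [left; apply Hc|lra]. }
(* One of [k] and [S k] is even, and the coefficient there is some [c j > 0]; the other coefficient
   is 0. *)
assert (Hpos : 0 < p k + p (S k)).
{ assert (H0 := Hp k); assert (H1 := Hp (S k)); unfold p, even_coef in *.
  rewrite Nat.even_succ, <- Nat.negb_even in *.
  destruct (Nat.even k); simpl negb in *; cbv iota in *.
  - destruct (Hc (Nat.div2 k)); lra.
  - destruct (Hc (Nat.div2 (S k))); lra. }
assert (HpM : forall n, Rabs (p n) <= M).
{ intros n; unfold p, even_coef; destruct (Hc (Nat.div2 n)).
  destruct (Nat.even n); rewrite Rabs_pos_eq; lra. }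
assert (HR : Rbar_lt (Rabs r) (CV_radius p)).
{ apply Rabs_lt_CV_radius with M; trivial; rewrite Rabs_pos_eq; lra. }
assert (Heq : locally r (fun t => PSeries p t = f t)).
{ apply filter_imp with (fun t => 0 < t < 1).
  - intros t Ht; apply is_pseries_unique.
    replace (f t) with (f t + t * 0) by ring.
    apply is_pseries_odd_even.
    + apply is_pseries_ext with (2 := Hf t Ht).
      intros n; symmetry; apply even_coef_even.
    + apply is_pseries_ext with (fun _ => 0).
      * intros n; symmetry; apply even_coef_odd.
      * apply is_pseries_R; apply (is_series_ext (fun _ => 0)).
        { intros n; symmetry; apply Rmult_0_l. }
        apply filterlim_ext with (fun _ : nat => 0); [|apply filterlim_const].
        intros n; symmetry; rewrite sum_n_Reals; induction n; simpl; lra.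
  - apply (open_and _ _ (open_gt 0) (open_lt 1)); exact Hr. }
split.
- apply ex_derive_n_ext_loc with (1 := Heq); now apply ex_derive_n_PSeries.
- rewrite <- (Derive_n_ext_loc _ _ k r Heq), Derive_n_PSeries by trivial.
  assert (Hf0 : forall n m, 0 < INR (fact n) / INR (fact m)).
  { intros n m; apply Rdiv_lt_0_compat; apply INR_fact_lt_0. }
  apply PSeries_gt_0; try lra.
  + intros n; unfold PS_derive_n; apply Rmult_le_pos; [left; apply Hf0|apply Hp].
  + unfold PS_derive_n; simpl (0 + k)%nat; simpl (1 + k)%nat.
    assert (H0 := Hf0 k 0%nat); assert (H1 := Hf0 (S k) 1%nat).
    assert (G0 := Hp k); assert (G1 := Hp (S k)).
    destruct G0 as [G0|G0].
    * apply Rplus_lt_le_0_compat; [now apply Rmult_lt_0_compat|apply Rmult_le_pos; lra].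
    * apply Rplus_le_lt_0_compat; [apply Rmult_le_pos; lra|apply Rmult_lt_0_compat; lra].
  + apply CV_radius_inside; rewrite CV_radius_derive_n; exact HR.
Qed.

(** * Expansions of the elliptic integral and of arth *)

(** These are the Maclaurin coefficients of (1-y)^(-1/2). Their square is [acoef]: one factor comes
    from expanding the integrand of [ellK], the other from the integral of sin^(2n). *)
Definition binom_coef (n : nat) : R := pochhammer (1 / 2) n / INR (fact n).

Lemma binom_coef_S (n : nat) :
  binom_coef (S n) = binom_coef n * ((2 * INR n + 1) / (2 * INR n + 2)).
Proof.
unfold binom_coef; cbn [pochhammer].
rewrite fact_simpl, mult_INR, S_INR.
assert (H := pos_INR n); assert (H' := INR_fact_neq_0 n).
field; repeat split; trivial; lra.
Qed.

Lemma binom_coef_bounds (n : nat) : 0 < binom_coef n <= 1.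
Proof.
induction n as [|n IH].
- unfold binom_coef; simpl; lra.
- rewrite binom_coef_S; assert (H := pos_INR n).
  assert (Hq : 0 < (2 * INR n + 1) / (2 * INR n + 2) <= 1).
  { split; [apply Rdiv_lt_0_compat; lra|].
    apply Rmult_le_reg_r with (2 * INR n + 2); [lra|].
    unfold Rdiv; rewrite Rmult_assoc, Rinv_l; lra. }
  split; [apply Rmult_lt_0_compat; lra|nra].
Qed.

Lemma Rabs_binom_coef (n : nat) : Rabs (binom_coef n) <= 1.
Proof. destruct (binom_coef_bounds n); rewrite Rabs_pos_eq; lra. Qed.

Lemma acoef_binom_coef (n : nat) : acoef n = binom_coef n ^ 2.
Proof. reflexivity. Qed.

(* [f = PSeries binom_coef] satisfies [(1 - y) f' = f / 2], so [f * sqrt (1 - y)] is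
   constant. *)
Lemma PSeries_binom_coef (y : R) :
  0 <= y < 1 -> PSeries binom_coef y = / sqrt (1 - y).
Proof.
intros Hy.
set (f := PSeries binom_coef).
assert (Hder : forall t, 0 <= t < 1 ->
   is_derive f t (PSeries (PS_derive binom_coef) t) /\
   (1 - t) * PSeries (PS_derive binom_coef) t = f t / 2).
{ intros t Ht.
  assert (HR : Rbar_lt (Rabs t) (CV_radius binom_coef)).
  { apply Rabs_lt_CV_radius with 1; [apply Rabs_binom_coef|rewrite Rabs_pos_eq; lra]. }
  split; [now apply is_derive_PSeries|].
  assert (Hf := CV_radius_inside _ _ HR).
  assert (Hd := ex_pseries_derive _ _ HR).
  (* Coefficientwise (n+1) b_(n+1) = n b_n + b_n / 2, where n b_n is the coefficient of t f'(t). *)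
  assert (Heq : PSeries (PS_derive binom_coef) t =
    PSeries (PS_plus (PS_incr_1 (PS_derive binom_coef)) (PS_scal (/ 2) binom_coef)) t).
  { apply PSeries_ext; intros n.
    assert (Hc : PS_derive binom_coef n = (INR n + / 2) * binom_coef n).
    { unfold PS_derive; rewrite binom_coef_S, S_INR; assert (H := pos_INR n); field; lra. }
    rewrite Hc; unfold PS_plus, PS_scal, scal; simpl; unfold mult; simpl.
    destruct n as [|n]; simpl PS_incr_1.
    - unfold zero; simpl; unfold plus; simpl; ring.
    - unfold PS_derive, plus; cbn [AbelianMonoid.plus]; simpl; ring. }
  rewrite PSeries_plus in Heq.
  - rewrite PSeries_incr_1, PSeries_scal in Heq.
    fold f in Heq; set (d := PSeries (PS_derive binom_coef) t) in *; lra.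
  - now apply ex_pseries_incr_1.
  - apply ex_pseries_scal; trivial; apply Rmult_comm. }
assert (Hconst : f y * sqrt (1 - y) = f 0 * sqrt (1 - 0)).
{ destruct (Req_dec y 0) as [->|Hne]; [reflexivity|].
  symmetry; apply (eq_is_derive (fun t => f t * sqrt (1 - t)) 0 y); [|lra].
  intros t Ht; destruct (Hder t) as [H1 H2]; [lra|].
  assert (Hs : 0 < sqrt (1 - t)) by (apply sqrt_lt_R0; lra).
  assert (Hs2 : sqrt (1 - t) * sqrt (1 - t) = 1 - t) by (apply sqrt_sqrt; lra).
  replace (@zero R_NormedModule) with
     (PSeries (PS_derive binom_coef) t * sqrt (1 - t) + f t * (- / (2 * sqrt (1 - t)))).
  - apply (is_derive_mult f (fun t => sqrt (1 - t)) t); trivial.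
    + auto_derive; [lra|].
      replace (1 + - t) with (1 - t) by ring; field; lra.
    + intros; apply Rmult_comm.
  - change zero with 0.
    apply Rmult_eq_reg_r with (sqrt (1 - t)); [|lra].
    transitivity ((1 - t) * PSeries (PS_derive binom_coef) t - f t / 2); [|lra].
    set (s := sqrt (1 - t)) in *; rewrite <- Hs2; field; lra. }
subst f; rewrite PSeries_0 in Hconst.
replace (1 - 0) with 1 in Hconst by ring; rewrite sqrt_1 in Hconst.
assert (Hs : 0 < sqrt (1 - y)) by (apply sqrt_lt_R0; lra).
apply Rmult_eq_reg_r with (sqrt (1 - y)); [|lra].
rewrite Hconst, Rinv_l by lra; unfold binom_coef; simpl; lra.
Qed.

(** All coefficients are at most 1, so the remainder is dominated by a geometric tail. The error
    term depends on [x] only: being uniform in [y], it can be integrated with y = x sin^2 t. *)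
Lemma binom_partial_sum (x y : R) (N : nat) :
  0 <= y <= x -> x < 1 ->
  sum_n (fun k => binom_coef k * y ^ k) N <= / sqrt (1 - y) <=
  sum_n (fun k => binom_coef k * y ^ k) N + x ^ S N / (1 - x).
Proof.
intros Hy Hx.
rewrite <- PSeries_binom_coef by lra.
rewrite (PSeries_decr_n _ N).
2:{ apply CV_radius_inside, Rabs_lt_CV_radius with 1;
    [apply Rabs_binom_coef|rewrite Rabs_pos_eq; lra]. }
rewrite sum_n_Reals.
set (T := PSeries (PS_decr_n binom_coef (S N)) y).
assert (HT : 0 <= T <= / (1 - x)).
{ assert (Hg := is_series_geom x ltac:(rewrite Rabs_pos_eq; lra)).
  assert (Hb : forall k, 0 <= PS_decr_n binom_coef (S N) k * y ^ k <= x ^ k).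
  { intros k; unfold PS_decr_n; destruct (binom_coef_bounds (S N + k)) as [H1 H2].
    assert (H3 : 0 <= y ^ k) by (apply pow_le; lra).
    assert (H4 : y ^ k <= x ^ k) by (apply pow_incr; lra).
    split; [apply Rmult_le_pos; lra|nra]. }
  assert (Hex : ex_series (fun k => x ^ k)) by (exists (/ (1 - x)); exact Hg).
  split.
  - replace 0 with (Series (fun k : nat => 0 * 0)) by (rewrite Series_scal_l; ring).
    apply Series_le.
    + intros k; rewrite Rmult_0_l; split; [lra|apply Hb].
    + apply (ex_series_le (fun k => PS_decr_n binom_coef (S N) k * y ^ k) (fun k => x ^ k));
        trivial.
      intros k; unfold norm; simpl; unfold abs; simpl.
      rewrite Rabs_pos_eq; apply Hb.
  - rewrite <- (is_series_unique _ _ Hg); now apply Series_le. }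
assert (Hp : 0 <= y ^ S N) by (apply pow_le; lra).
assert (Hq : y ^ S N <= x ^ S N) by (apply pow_incr; lra).
split; [nra|].
apply Rplus_le_compat_l; unfold Rdiv.
apply Rmult_le_compat; lra.
Qed.

(** Wallis's recursion: the primitive used vanishes at both endpoints, which ties the integrals for
    [n] and [S n] together. *)
Lemma is_RInt_sin_pow_even (n : nat) :
  is_RInt (fun t => sin t ^ (2 * n)) 0 (PI / 2) (PI / 2 * binom_coef n).
Proof.
induction n as [|n IH].
- replace (PI / 2 * binom_coef 0) with (scal (PI / 2 - 0) 1).
  + apply (@is_RInt_const R_NormedModule).
  + unfold binom_coef, scal; simpl; unfold mult; simpl; field.
- assert (Hn := pos_INR n).
  (* The integrand is the derivative of [cos t * sin t ^ (2 n + 1)]. *)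
  assert (H : is_RInt (fun t => (2 * INR n + 1) * sin t ^ (2 * n)
                           - (2 * INR n + 2) * sin t ^ (2 * S n)) 0 (PI / 2) 0).
  { replace 0 with (minus (cos (PI / 2) * sin (PI / 2) ^ (2 * n + 1))
                          (cos 0 * sin 0 ^ (2 * n + 1))) at 2.
    2:{ rewrite cos_PI2, sin_0, pow_i by lia; unfold minus, plus, opp; simpl; ring. }
    apply (is_RInt_derive (fun t => cos t * sin t ^ (2 * n + 1))).
    - intros t _; auto_derive; trivial.
      change (n + (n + 0))%nat with (2 * n)%nat.
      replace (pred (2 * n + 1)) with (2 * n)%nat by lia.
      replace (2 * S n)%nat with (2 * n + 2)%nat by lia.
      rewrite !pow_add, plus_INR, mult_INR; simpl INR.
      assert (Hc := sin2_cos2 t); unfold Rsqr in Hc.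
      replace (sin t ^ 2) with (sin t * sin t) by ring; rewrite pow_1.
      set (S2 := sin t ^ (2 * n)).
      replace (1 * cos t) with (cos t) by ring.
      transitivity (S2 * ((2 * INR n + 1) * (cos t * cos t) - sin t * sin t)); [ring|].
      replace (cos t * cos t) with (1 - sin t * sin t) by lra; ring.
    - intros t _; apply (@ex_derive_continuous R_AbsRing R_NormedModule); auto_derive; trivial. }
  assert (H' := is_RInt_scal _ _ _ (/ (2 * INR n + 2)) _
     (is_RInt_minus _ _ _ _ _ _ (is_RInt_scal _ _ _ (2 * INR n + 1) _ IH) H)).
  rewrite binom_coef_S.
  replace (PI / 2 * (binom_coef n * ((2 * INR n + 1) / (2 * INR n + 2)))) with
    (scal (/ (2 * INR n + 2)) (minus (scal (2 * INR n + 1) (PI / 2 * binom_coef n)) 0)).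
  + apply is_RInt_ext with (2 := H').
    intros t _; unfold scal, minus, plus, opp; simpl; unfold mult; simpl; field; lra.
  + unfold scal, minus, plus, opp; simpl; unfold mult; simpl; field; lra.
Qed.

Lemma radicand_pos (r t : R) : 0 < r < 1 -> 0 < 1 - r ^ 2 * sin t ^ 2.
Proof.
intros Hr; assert (H := SIN_bound t).
assert (0 <= sin t ^ 2 <= 1) by (split; nra).
assert (0 < r ^ 2 < 1) by (split; nra); nra.
Qed.

Lemma is_RInt_ellK (r : R) :
  0 < r < 1 ->
  is_RInt (fun t => / sqrt (1 - r ^ 2 * sin t ^ 2)) 0 (PI / 2) (ellK r).
Proof.
intros Hr; unfold ellK; apply (@RInt_correct R_CompleteNormedModule), ex_RInt_continuous.
intros t _; assert (H := radicand_pos r t Hr).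
apply continuous_Rinv_comp; [|apply Rgt_not_eq, sqrt_lt_R0, H].
apply continuous_sqrt_comp, (@ex_derive_continuous R_AbsRing R_NormedModule).
  auto_derive; trivial.
Qed.

Lemma is_RInt_sum_n (f : nat -> R -> R) (l : nat -> R) (a b : R) (N : nat) :
  (forall k, is_RInt (f k) a b (l k)) ->
  is_RInt (fun t => sum_n (fun k => f k t) N) a b (sum_n l N).
Proof.
intros H; induction N as [|N IH].
- rewrite sum_O; apply is_RInt_ext with (2 := H 0%nat); intros t _; now rewrite sum_O.
- rewrite sum_Sn; apply is_RInt_ext with (2 := is_RInt_plus _ _ _ _ _ _ IH (H (S N))).
  intros t _; now rewrite sum_Sn.
Qed.

(** Sum and integral are interchanged by a squeeze: integrating the uniform two-sided bound on the
    binomial partial sums traps the partial sums [P N] between [ellK r] minus a geometric error and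
    [ellK r]. *)
Lemma is_pseries_ellK (r : R) :
  0 < r < 1 -> is_pseries acoef (r ^ 2) (2 / PI * ellK r).
Proof.
intros Hr; apply is_pseries_R; assert (HPI := PI_RGT_0).
assert (Hx : 0 < r ^ 2 < 1) by (split; nra).
set (x := r ^ 2) in *.
set (P := fun N => sum_n (fun k => x ^ k * (PI / 2 * binom_coef k ^ 2)) N).
assert (HP : forall N, ellK r - x ^ S N / (1 - x) * (PI / 2) <= P N <= ellK r).
{ intros N.
  assert (HI : is_RInt (fun t => sum_n (fun k => binom_coef k * (x * sin t ^ 2) ^ k) N)
                 0 (PI / 2) (P N)).
  { apply (is_RInt_sum_n (fun k t => binom_coef k * (x * sin t ^ 2) ^ k)).
    intros k.
    replace (x ^ k * (PI / 2 * binom_coef k ^ 2)) with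
      (scal (binom_coef k * x ^ k) (PI / 2 * binom_coef k))
      by (unfold scal; simpl; unfold mult; simpl; ring).
    apply is_RInt_ext with (2 := is_RInt_scal _ _ _ (binom_coef k * x ^ k) _
      (is_RInt_sin_pow_even k)).
    intros t _.
    change (binom_coef k * x ^ k * sin t ^ (2 * k) = binom_coef k * (x * sin t ^ 2) ^ k).
    rewrite Rpow_mult_distr, <- pow_mult; ring. }
  assert (Hb : forall t, 0 <= x * sin t ^ 2 <= x).
  { intros t; assert (H := SIN_bound t).
    assert (0 <= sin t ^ 2 <= 1) by (split; nra); nra. }
  split.
  - apply Rplus_le_reg_r with (x ^ S N / (1 - x) * (PI / 2)).
    replace (ellK r - x ^ S N / (1 - x) * (PI / 2) + x ^ S N / (1 - x) * (PI / 2))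
      with (ellK r) by ring.
    apply (is_RInt_le (fun t => / sqrt (1 - r ^ 2 * sin t ^ 2))
      (fun t => sum_n (fun k => binom_coef k * (x * sin t ^ 2) ^ k) N
                         + x ^ S N / (1 - x)) 0 (PI / 2)); [lra|now apply is_RInt_ellK| |].
    + apply (@is_RInt_plus R_NormedModule); trivial.
      replace (x ^ S N / (1 - x) * (PI / 2)) with (scal (PI / 2 - 0) (x ^ S N / (1 - x)))
        by (unfold scal; simpl; unfold mult; simpl; ring).
      apply (@is_RInt_const R_NormedModule).
    + intros t _; apply binom_partial_sum; trivial; lra.
  - apply (is_RInt_le (fun t => sum_n (fun k => binom_coef k * (x * sin t ^ 2) ^ k) N)
      (fun t => / sqrt (1 - r ^ 2 * sin t ^ 2)) 0 (PI / 2)); trivial;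
      [lra|now apply is_RInt_ellK|].
    intros t _; apply (binom_partial_sum x); trivial; lra. }
assert (HL : is_lim_seq P (ellK r)).
{ apply (is_lim_seq_le_le (fun N => ellK r - x ^ S N / (1 - x) * (PI / 2)) P
          (fun _ => ellK r)); [exact HP| |apply is_lim_seq_const].
  assert (Hg : is_lim_seq (fun n => x ^ S n) 0).
  { apply (is_lim_seq_incr_1 (fun n => x ^ n)), is_lim_seq_geom; rewrite Rabs_pos_eq; lra. }
  replace (Finite (ellK r)) with (Rbar_plus (ellK r) (Rbar_mult (- (/ (1 - x) * (PI / 2))) 0)).
  2:{ simpl; f_equal; ring. }
  apply is_lim_seq_ext with (fun n => ellK r + - (/ (1 - x) * (PI / 2)) * x ^ S n).
  { intros n; unfold Rdiv; ring. }
  apply is_lim_seq_plus'; [apply is_lim_seq_const|].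
  apply (is_lim_seq_scal_l (fun n => x ^ S n) _ 0 Hg). }
apply (is_series_ext (fun k => scal (2 / PI) (x ^ k * (PI / 2 * binom_coef k ^ 2)))).
{ intros k; rewrite acoef_binom_coef; unfold scal; simpl; unfold mult; simpl; field; lra. }
apply (is_series_scal (2 / PI) (fun k => x ^ k * (PI / 2 * binom_coef k ^ 2)) (ellK r)), HL.
Qed.

(** * The inverse hyperbolic tangent as an integral and as a series *)

Lemma arth_gt_0 (r : R) : 0 < r < 1 -> 0 < arth r.
Proof.
intros Hr; unfold arth.
assert (0 < ln ((1 + r) / (1 - r))); [|lra].
rewrite <- ln_1; apply ln_increasing; [lra|].
apply Rmult_lt_reg_r with (1 - r); [lra|].
unfold Rdiv; rewrite Rmult_assoc, Rinv_l; lra.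
Qed.

Lemma arth_div_gt_0 (r : R) : 0 < r < 1 -> 0 < arth r / r.
Proof. intros Hr; apply Rdiv_lt_0_compat; [now apply arth_gt_0|lra]. Qed.

Lemma is_RInt_sin_ellK (r : R) :
  0 < r < 1 ->
  is_RInt (fun t => sin t / sqrt (1 - r ^ 2 * sin t ^ 2)) 0 (PI / 2) (arth r / r).
Proof.
intros Hr; assert (HPI := PI_RGT_0).
(* With u = cos t the radicand becomes 1 - r^2 + r^2 u^2, and the extra factor sin t supplies -du;
   this is the resulting elementary primitive. *)
set (g := fun t => - / r * ln (r * cos t + sqrt (1 - r ^ 2 * sin t ^ 2))).
assert (Hg : arth r / r = minus (g (PI / 2)) (g 0)).
{ unfold g, minus, plus, opp; simpl plus; rewrite cos_PI2, sin_PI2, cos_0, sin_0.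
  replace (r * 0 + sqrt (1 - r ^ 2 * 1 ^ 2)) with (sqrt ((1 + r) * (1 - r)))
    by (rewrite Rmult_0_r, Rplus_0_l; f_equal; ring).
  replace (1 - r ^ 2 * 0 ^ 2) with 1 by ring; rewrite sqrt_1.
  rewrite <- Rpower_sqrt by nra; unfold Rpower; rewrite ln_exp, ln_mult by lra.
  unfold arth; rewrite ln_div by lra; simpl.
  replace (r * 1 + 1) with (1 + r) by ring; field; lra. }
rewrite Hg.
assert (Hpos : forall t, 0 <= t <= PI / 2 -> 0 <= cos t) by (intros t Ht; apply cos_ge_0; lra).
apply (is_RInt_derive g).
- intros t Ht; rewrite Rmin_left, Rmax_right in Ht by lra.
  assert (H := radicand_pos r t Hr).
  assert (Hs := sqrt_lt_R0 _ H).
  assert (Hc := Hpos t Ht).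
  unfold g; auto_derive.
  + change (r * (r * 1)) with (r ^ 2); change (sin t * (sin t * 1)) with (sin t ^ 2).
    replace (1 + - (r ^ 2 * sin t ^ 2)) with (1 - r ^ 2 * sin t ^ 2) by ring.
    repeat split; trivial; nra.
  + change (r * (r * 1)) with (r ^ 2); change (sin t * (sin t * 1)) with (sin t ^ 2).
    replace (1 + - (r ^ 2 * sin t ^ 2)) with (1 - r ^ 2 * sin t ^ 2) by ring.
    set (s := sqrt (1 - r ^ 2 * sin t ^ 2)) in *; simpl.
    field; split; [|split]; try lra; nra.
- intros t Ht; assert (H := radicand_pos r t Hr).
  apply (continuous_mult sin (fun t => / sqrt (1 - r ^ 2 * sin t ^ 2))).
  + apply continuous_sin.
  + apply continuous_Rinv_comp; [|apply Rgt_not_eq, sqrt_lt_R0, H].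
    apply continuous_sqrt_comp, (@ex_derive_continuous R_AbsRing R_NormedModule).
  auto_derive; trivial.
Qed.

(* [sqrt (1 - r^2 s^2) >= 1 - s], so the integrands of [ellK r] and of
   [arth r / r] differ by at most 1. *)
Lemma ellK_arth_bounds (r : R) :
  0 < r < 1 -> arth r / r <= ellK r <= arth r / r + PI / 2.
Proof.
intros Hr; assert (HPI := PI_RGT_0).
assert (HK := is_RInt_ellK r Hr); assert (HA := is_RInt_sin_ellK r Hr).
split.
- apply is_RInt_le with (2 := HA) (3 := HK); [lra|].
  intros t Ht; assert (Hs := sqrt_lt_R0 _ (radicand_pos r t Hr)).
  assert (H := SIN_bound t).
  assert (Hi := Rinv_0_lt_compat _ Hs); unfold Rdiv; nra.
- assert (H1 : is_RInt (fun _ => 1) 0 (PI / 2) (PI / 2)).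
  { replace (PI / 2) with (scal (PI / 2 - 0) 1) at 2
      by (unfold scal; simpl; unfold mult; simpl; ring).
    apply (@is_RInt_const R_NormedModule). }
  apply is_RInt_le with (2 := HK) (3 := is_RInt_plus _ _ _ _ _ _ HA H1); [lra|].
  intros t Ht; unfold plus; simpl.
  assert (Hrad := radicand_pos r t Hr).
  assert (Hs := sqrt_lt_R0 _ Hrad).
  assert (H : 0 <= sin t <= 1) by (split; [apply sin_ge_0; lra|apply SIN_bound]).
  assert (Hle : 1 - sin t <= sqrt (1 - r ^ 2 * sin t ^ 2)).
  { rewrite <- (sqrt_square (1 - sin t)) by lra; apply sqrt_le_1_alt.
    assert (0 <= (1 - r ^ 2) * sin t ^ 2) by (apply Rmult_le_pos; nra); nra. }
  fold (r ^ 2) (sin t ^ 2).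
  set (s := sqrt _) in *.
  apply Rmult_le_reg_r with s; trivial.
  replace ((sin t / s + 1) * s) with (sin t + s) by (field; lra).
  rewrite Rinv_l; lra.
Qed.

Definition odd_inv (n : nat) : R := / (2 * INR n + 1).

Lemma odd_inv_bounds (n : nat) : 0 < odd_inv n <= 1.
Proof.
assert (H := pos_INR n); unfold odd_inv; split.
- apply Rinv_0_lt_compat; lra.
- rewrite <- Rinv_1 at 2; apply Rinv_le_contravar; lra.
Qed.

Lemma Rabs_odd_inv (n : nat) : Rabs (odd_inv n) <= 1.
Proof. destruct (odd_inv_bounds n); rewrite Rabs_pos_eq; lra. Qed.

(** Both t S(t^2), with S the sum of the series, and arth t vanish at 0 and have derivative
    1/(1-t^2). For the first this is the coefficient identity (1 + 2n) b_n = 1 summed as a geometric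
    series. *)
Lemma is_pseries_arth (r : R) :
  0 < r < 1 -> is_pseries odd_inv (r ^ 2) (arth r / r).
Proof.
intros Hr.
assert (Hx : forall t, 0 <= t <= r -> Rabs (t ^ 2) < 1).
{ intros t Ht; rewrite Rabs_pos_eq; nra. }
assert (HB := Rabs_odd_inv).
replace (arth r / r) with (PSeries odd_inv (r ^ 2)).
{ apply is_pseries_of_bounded with 1; trivial; apply Hx; lra. }
assert (H : 0 * PSeries odd_inv (0 ^ 2) - arth 0 = r * PSeries odd_inv (r ^ 2) - arth r).
{ apply (eq_is_derive (fun t => t * PSeries odd_inv (t ^ 2) - arth t) 0 r); [|lra].
  intros t Ht.
  assert (HR := Rabs_lt_CV_radius odd_inv 1 (t ^ 2) HB (Hx t Ht)).
  set (d := PSeries (PS_derive odd_inv) (t ^ 2)).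
  assert (Hd : is_derive (PSeries odd_inv) (t ^ 2) d) by now apply is_derive_PSeries.
  assert (Hval : PSeries odd_inv (t ^ 2) + 2 * t ^ 2 * d = / (1 - t ^ 2)).
  { rewrite <- (is_series_unique _ _ (is_series_geom (t ^ 2) (Hx t Ht))).
    transitivity (PSeries (PS_plus odd_inv (PS_scal 2 (PS_incr_1 (PS_derive odd_inv)))) (t ^ 2)).
    - rewrite PSeries_plus.
      + rewrite PSeries_scal, PSeries_incr_1; unfold d; ring.
      + now apply CV_radius_inside.
      + apply ex_pseries_scal; [apply Rmult_comm|].
        now apply ex_pseries_incr_1, ex_pseries_derive.
    - unfold PSeries; apply Series_ext; intros n.
      rewrite <- (Rmult_1_l ((t ^ 2) ^ n)) at 2; f_equal.
      unfold PS_plus, PS_scal, scal, plus; simpl; unfold mult; simpl.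
      destruct n as [|n]; simpl PS_incr_1.
      + unfold odd_inv; simpl; unfold zero; simpl; field.
      + unfold PS_derive, odd_inv; assert (Hn := pos_INR n); rewrite S_INR; field; lra. }
  assert (Hsq : is_derive (fun t => t ^ 2) t (2 * t)) by (auto_derive; [trivial|ring]).
  assert (Hc := is_derive_comp _ _ _ _ _ Hd Hsq).
  assert (Ha : is_derive arth t (/ (1 - t ^ 2))).
  { unfold arth; auto_derive.
    - split; [lra|split; trivial]; apply Rdiv_lt_0_compat; lra.
    - field; split; [nra|lra]. }
  assert (Hm := is_derive_minus _ _ _ _ _
    (is_derive_mult (fun t => t) _ t 1 _ (is_derive_id t) Hc Rmult_comm) Ha).
  replace (@zero R_NormedModule) with
    (minus (plus (mult 1 (PSeries odd_inv (t ^ 2))) (mult t (scal (2 * t) d))) (/ (1 - t ^ 2))).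
  - exact Hm.
  - rewrite <- Hval; unfold minus, plus, opp, scal, zero; simpl; unfold mult; simpl; ring. }
replace (arth 0) with 0 in H.
2:{ unfold arth; replace ((1 + 0) / (1 - 0)) with 1 by field; rewrite ln_1; ring. }
apply Rmult_eq_reg_r with r; [|lra].
replace (arth r / r * r) with (arth r) by (field; lra); lra.
Qed.

(** * Quotients by arth r / r *)

Lemma odd_inv_log_convex (m n : nat) :
  (m <= n)%nat -> odd_inv (S m) * odd_inv n <= odd_inv (S n) * odd_inv m.
Proof.
intros Hmn; apply le_INR in Hmn; assert (Hm := pos_INR m).
unfold odd_inv; rewrite !S_INR, <- !Rinv_mult.
apply Rinv_le_contravar; [apply Rmult_lt_0_compat|]; nra.
Qed.

Lemma acoef_S (n : nat) :
  acoef (S n) = acoef n * ((2 * INR n + 1) / (2 * INR n + 2)) ^ 2.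
Proof. now rewrite !acoef_binom_coef, binom_coef_S, Rpow_mult_distr. Qed.

Lemma acoef_pos (n : nat) : 0 < acoef n.
Proof. rewrite acoef_binom_coef; apply pow_lt, binom_coef_bounds. Qed.

Definition coef_ratio (n : nat) : R := (2 * INR n + 1) * acoef n.

Lemma coef_ratio_decr (n : nat) : coef_ratio (S n) < coef_ratio n.
Proof.
unfold coef_ratio; rewrite acoef_S, S_INR.
assert (Hn := pos_INR n); assert (Ha := acoef_pos n).
(* The decrease rests on (2n+3)(2n+1) = (2n+2)^2 - 1. *)
replace ((2 * (INR n + 1) + 1) * (acoef n * ((2 * INR n + 1) / (2 * INR n + 2)) ^ 2)) with
  ((2 * INR n + 1) * acoef n * (1 - / (2 * INR n + 2) ^ 2)) by (field; lra).
assert (0 < / (2 * INR n + 2) ^ 2) by (apply Rinv_0_lt_compat, pow_lt; lra).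
assert (0 < (2 * INR n + 1) * acoef n) by (apply Rmult_lt_0_compat; lra).
nra.
Qed.

Lemma coef_ratio_anti (m n : nat) : (m <= n)%nat -> coef_ratio n <= coef_ratio m.
Proof.
induction 1 as [|n _ IH]; [lra|]; assert (H := coef_ratio_decr n); lra.
Qed.

(** This is the origin of the constant 3/4 in [atilde]: it makes the coefficient of index 1
    vanish. *)
Lemma coef_ratio_1 : coef_ratio 1 = 3 / 4.
Proof. unfold coef_ratio, acoef; simpl; field. Qed.

Definition diff_coef (kap : R) (n : nat) : R := kap * odd_inv n - acoef n.

Lemma diff_coef_eq (kap : R) (n : nat) :
  diff_coef kap n = odd_inv n * (kap - coef_ratio n).
Proof.
unfold diff_coef, coef_ratio, odd_inv; assert (Hn := pos_INR n); field; lra.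
Qed.

Lemma atilde_diff_coef (n : nat) : atilde n = diff_coef (3 / 4) n.
Proof.
unfold atilde, diff_coef, odd_inv; assert (Hn := pos_INR n); field; lra.
Qed.

Lemma diff_coef_bounds (kap : R) (m n : nat) :
  kap <= 1 -> coef_ratio m < kap -> (m <= n)%nat -> 0 < diff_coef kap n <= 1.
Proof.
intros Hk Hm Hmn; assert (H := coef_ratio_anti m n Hmn).
destruct (odd_inv_bounds n) as [H1 H2]; split.
- rewrite diff_coef_eq; apply Rmult_lt_0_compat; lra.
- unfold diff_coef; assert (Ha := acoef_pos n); nra.
Qed.

(** The ratio of the tail to [odd_inv] at [k] is b_(m+k) / b_k times [kap - coef_ratio (m + k)]. The
    first factor is nondecreasing by log-convexity; the second is positive and strictly
    increasing. *)
Lemma diff_coef_ratio_incr (kap : R) (m k : nat) :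
  coef_ratio m < kap ->
  diff_coef kap (m + k) * odd_inv (S k) < diff_coef kap (m + S k) * odd_inv k.
Proof.
intros Hm; rewrite !diff_coef_eq.
replace (m + S k)%nat with (S (m + k)) by lia.
assert (H1 := coef_ratio_decr (m + k)).
assert (H2 := coef_ratio_anti m (m + k) ltac:(lia)).
assert (H3 := odd_inv_log_convex k (m + k) ltac:(lia)).
destruct (odd_inv_bounds (m + k)) as [H4 _]; destruct (odd_inv_bounds (S k)) as [H5 _].
assert (H6 : 0 < odd_inv (S k) * odd_inv (m + k)) by now apply Rmult_lt_0_compat.
apply Rlt_le_trans with
  (odd_inv (S k) * odd_inv (m + k) * (kap - coef_ratio (S (m + k)))).
- replace (odd_inv (m + k) * (kap - coef_ratio (m + k)) * odd_inv (S k)) with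
    (odd_inv (S k) * odd_inv (m + k) * (kap - coef_ratio (m + k))) by ring.
  apply Rmult_lt_compat_l; lra.
- replace (odd_inv (S (m + k)) * (kap - coef_ratio (S (m + k))) * odd_inv k) with
    (odd_inv (S (m + k)) * odd_inv k * (kap - coef_ratio (S (m + k)))) by ring.
  apply Rmult_le_compat_r; lra.
Qed.

Definition tail_quotient (kap : R) (m : nat) : nat -> R :=
  quotient_coef (fun k => diff_coef kap (m + k)) odd_inv.

Lemma odd_inv_0 : odd_inv 0 = 1.
Proof. unfold odd_inv; simpl; field. Qed.

Lemma tail_quotient_bounds (kap : R) (m : nat) :
  kap <= 1 -> coef_ratio m < kap -> forall n, 0 < tail_quotient kap m n <= 1.
Proof.
intros Hk Hm n.
destruct (quotient_coef_pos (fun k => diff_coef kap (m + k)) odd_inv) with (n := n)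
  as [H1 H2].
- apply odd_inv_0.
- intros k; apply odd_inv_bounds.
- intros k l; apply odd_inv_log_convex.
- apply diff_coef_bounds with m; trivial; lia.
- intros k; now apply diff_coef_ratio_incr.
- split; [exact H1|].
  destruct (diff_coef_bounds kap m (m + n) Hk Hm); [lia|].
  unfold tail_quotient; lra.
Qed.

Lemma Rabs_tail_quotient (kap : R) (m : nat) :
  kap <= 1 -> coef_ratio m < kap -> forall n, Rabs (tail_quotient kap m n) <= 1.
Proof.
intros Hk Hm n; destruct (tail_quotient_bounds kap m Hk Hm n).
rewrite Rabs_pos_eq; lra.
Qed.

Lemma is_pseries_tail (kap : R) (m : nat) (r : R) :
  kap <= 1 -> coef_ratio m < kap -> 0 < r < 1 ->
  is_pseries (fun k => diff_coef kap (m + k)) (r ^ 2)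
    (PSeries (tail_quotient kap m) (r ^ 2) * (arth r / r)).
Proof.
intros Hk Hm Hr.
assert (Hx : Rabs (r ^ 2) < 1) by (apply Rabs_sqr_lt_1; lra).
assert (Hq := Rabs_tail_quotient kap m Hk Hm).
apply is_pseries_ext with (PS_mult (tail_quotient kap m) odd_inv).
{ exact (PS_mult_quotient_coef (fun k => diff_coef kap (m + k)) odd_inv odd_inv_0). }
apply is_pseries_mult.
- now apply is_pseries_of_bounded with 1.
- now apply is_pseries_arth.
- now apply Rabs_lt_CV_radius with 1.
- apply Rabs_lt_CV_radius with 1; trivial; apply Rabs_odd_inv.
Qed.

(** The source of all the later formulas: [kap = 1], [N = 0] gives [h1] and through it [h4], while
    [kap = 3 / 4], [N = n] gives [h2] and [h3]. *)
Lemma ellK_expansion (kap : R) (N : nat) (r : R) :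
  kap <= 1 -> coef_ratio (S N) < kap -> 0 < r < 1 ->
  2 / PI * ellK r =
  kap * (arth r / r) - sum_n (fun k => diff_coef kap k * r ^ (2 * k)) N
  - r ^ (2 * S N) * (PSeries (tail_quotient kap (S N)) (r ^ 2) * (arth r / r)).
Proof.
intros Hk Hm Hr.
assert (HD : is_pseries (diff_coef kap) (r ^ 2) (kap * (arth r / r) - 2 / PI * ellK r)).
{ apply is_pseries_ext with (PS_minus (PS_scal kap odd_inv) acoef).
  - intros n; reflexivity.
  - apply (is_pseries_minus (PS_scal kap odd_inv) acoef).
    + apply (is_pseries_scal kap odd_inv); [apply Rmult_comm|now apply is_pseries_arth].
    + now apply is_pseries_ellK. }
assert (H := PSeries_decr_n (diff_coef kap) N (r ^ 2) (ex_intro _ _ HD)).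
rewrite (is_pseries_unique _ _ _ HD) in H.
change (PS_decr_n (diff_coef kap) (S N)) with (fun k => diff_coef kap (S N + k)) in H.
rewrite (is_pseries_unique _ _ _ (is_pseries_tail kap (S N) r Hk Hm Hr)) in H.
rewrite (sum_n_ext _ (fun k => diff_coef kap k * (r ^ 2) ^ k)), sum_n_Reals.
- rewrite pow_mult; lra.
- intros k; now rewrite pow_mult.
Qed.

(** * Limits at r = 1 *)

Lemma filterlim_arth_div : filterlim (fun r => arth r / r) (at_left 1) (Rbar_locally p_infty).
Proof.
intros P [M HM].
assert (HE : 0 < exp (- (2 * M))) by apply exp_pos.
(* For r > 1 - exp(-2M) one has (1+r)/(1-r) > 1/(1-r) > exp(2M), hence arth r > M. The maximum with
   0 keeps [r] positive when [M] is negative. *)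
assert (Hlt : Rmax (1 - exp (- (2 * M))) 0 < 1) by (apply Rmax_lub_lt; lra).
apply filter_imp with (2 := at_left_1_above _ Hlt).
intros r [Hr Hr1]; apply HM.
apply Rmax_Rlt in Hr; destruct Hr as [HrM Hr0].
assert (Hq : exp (2 * M) < (1 + r) / (1 - r)).
{ apply Rlt_trans with (/ (1 - r)).
  - rewrite <- (Ropp_involutive (2 * M)), exp_Ropp.
    apply Rinv_lt_contravar; [apply Rmult_lt_0_compat|]; lra.
  - unfold Rdiv; rewrite <- (Rmult_1_l (/ (1 - r))) at 1.
    apply Rmult_lt_compat_r; [apply Rinv_0_lt_compat|]; lra. }
assert (Ha : M < arth r).
{ unfold arth; apply ln_increasing in Hq; [|apply exp_pos].
  rewrite ln_exp in Hq; lra. }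
assert (Hpos := arth_div_gt_0 r (conj Hr0 Hr1)).
assert (H : arth r / r * r = arth r) by (field; lra).
nra.
Qed.

Lemma filterlim_inv_arth_div : filterlim (fun r => / (arth r / r)) (at_left 1) (locally 0).
Proof.
eapply filterlim_comp; [exact filterlim_arth_div|].
apply (filterlim_Rbar_inv p_infty); discriminate.
Qed.

Lemma filterlim_Rplus_fun {T : Type} {F : (T -> Prop) -> Prop} {FF : Filter F}
  (f g : T -> R) (a b : R) :
  filterlim f F (locally a) -> filterlim g F (locally b) ->
  filterlim (fun x => f x + g x) F (locally (a + b)).
Proof.
intros Hf Hg.
exact (filterlim_comp_2 f g Rplus Hf Hg (filterlim_plus (V := R_NormedModule) a b)).
Qed.

Lemma filterlim_Rmult_fun {T : Type} {F : (T -> Prop) -> Prop} {FF : Filter F}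
  (f g : T -> R) (a b : R) :
  filterlim f F (locally a) -> filterlim g F (locally b) ->
  filterlim (fun x => f x * g x) F (locally (a * b)).
Proof.
intros Hf Hg.
exact (filterlim_comp_2 f g Rmult Hf Hg (filterlim_mult (K := R_AbsRing) a b)).
Qed.

Lemma filterlim_at_left_1_of_ex_derive (f : R -> R) :
  ex_derive f 1 -> filterlim f (at_left 1) (locally (f 1)).
Proof.
intros Hf P HP; apply filter_le_within.
exact (@ex_derive_continuous R_AbsRing R_NormedModule f 1 Hf P HP).
Qed.

Lemma h1_ellK (r : R) : 0 < r < 1 -> h1 r = ellK r / (arth r / r).
Proof.
intros Hr; assert (H := arth_gt_0 r Hr); unfold h1; field; split; lra.
Qed.

Lemma filterlim_h1_at_left_1 : filterlim h1 (at_left 1) (locally 1).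
Proof.
apply (filterlim_le_le (fun _ => 1) h1 (fun r => 1 + PI / 2 * / (arth r / r)) 1).
- apply filter_imp with (2 := at_left_1_above 0 Rlt_0_1); intros r Hr.
  rewrite h1_ellK by trivial.
  assert (HA := arth_div_gt_0 r Hr); destruct (ellK_arth_bounds r Hr) as [H1 H2].
  set (A := arth r / r) in *; split.
  + apply Rmult_le_reg_r with A; trivial.
    unfold Rdiv; rewrite Rmult_assoc, Rinv_l; lra.
  + apply Rmult_le_reg_r with A; trivial.
    unfold Rdiv; rewrite Rmult_plus_distr_r, !Rmult_assoc, Rinv_l; lra.
- apply filterlim_const.
- assert (HL : filterlim (fun r => 1 + PI / 2 * / (arth r / r)) (at_left 1)
                  (locally (1 + PI / 2 * 0))).
  { apply filterlim_Rplus_fun; [apply filterlim_const|].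
    apply filterlim_Rmult_fun; [apply filterlim_const|exact filterlim_inv_arth_div]. }
  rewrite Rmult_0_r, Rplus_0_r in HL; exact HL.
Qed.

Lemma ex_derive_sum_pow (c : nat -> R) (N : nat) (x : R) :
  ex_derive (fun r => sum_n (fun k => c k * r ^ (2 * k)) N) x.
Proof.
induction N as [|N IH].
- apply (ex_derive_ext (fun r => c O * r ^ (2 * 0))).
  + intros t; now rewrite sum_O.
  + auto_derive; trivial.
- apply (ex_derive_ext (fun r => plus (sum_n (fun k => c k * r ^ (2 * k)) N)
                                   (c (S N) * r ^ (2 * S N)))).
  + intros t; now rewrite sum_Sn.
  + apply (@ex_derive_plus R_AbsRing R_NormedModule); [exact IH|auto_derive; trivial].
Qed.

(** Nothing is summed at x = 1. Solving [ellK_expansion] for the quotient series leaves [kap], a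
    multiple of [h1], which tends to 1, and a polynomial divided by arth r / r, which tends to 0. *)
Lemma filterlim_tail_quotient (kap : R) (N : nat) :
  kap <= 1 -> coef_ratio (S N) < kap ->
  filterlim (fun r => PSeries (tail_quotient kap (S N)) (r ^ 2)) (at_left 1)
    (locally (kap - 2 / PI)).
Proof.
intros Hk Hm; assert (HPI := PI_RGT_0).
set (s := fun r => sum_n (fun k => diff_coef kap k * r ^ (2 * k)) N).
apply filterlim_ext_loc with
  (fun r => (kap + (- (2 / PI) * h1 r + - s r * / (arth r / r))) * / r ^ (2 * S N)).
- apply filter_imp with (2 := at_left_1_above 0 Rlt_0_1); intros r Hr.
  rewrite h1_ellK by trivial.
  assert (HA := arth_div_gt_0 r Hr).
  assert (HE := ellK_expansion kap N r Hk Hm Hr); fold (s r) in HE.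
  assert (Hp : 0 < r ^ (2 * S N)) by (apply pow_lt; lra).
  set (A := arth r / r) in *; set (p := r ^ (2 * S N)) in *.
  set (Q := PSeries _ _) in *.
  transitivity ((kap * A - 2 / PI * ellK r - s r) / (A * p)); [field; lra|].
  rewrite HE; field; lra.
- replace (kap - 2 / PI) with
    ((kap + (- (2 / PI) * 1 + - s 1 * 0)) * / 1 ^ (2 * S N)) by (rewrite pow1; field; lra).
  apply filterlim_Rmult_fun.
  + apply filterlim_Rplus_fun; [apply filterlim_const|].
    apply filterlim_Rplus_fun; apply filterlim_Rmult_fun.
    * apply filterlim_const.
    * exact filterlim_h1_at_left_1.
    * apply (filterlim_at_left_1_of_ex_derive (fun r => - s r)).
      apply (@ex_derive_opp R_AbsRing R_NormedModule), ex_derive_sum_pow.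
    * exact filterlim_inv_arth_div.
  + apply (filterlim_at_left_1_of_ex_derive (fun r => / r ^ (2 * S N))).
    auto_derive; rewrite pow1; lra.
Qed.

(** * The series of h1 and the range of h4 *)

Definition ratio_coef : nat -> R := tail_quotient 1 1.

Lemma coef_ratio_1_lt : coef_ratio 1 < 1.
Proof. rewrite coef_ratio_1; lra. Qed.

Lemma ratio_coef_bounds (n : nat) : 0 < ratio_coef n <= 1.
Proof. apply tail_quotient_bounds; [lra|exact coef_ratio_1_lt]. Qed.

Lemma Rabs_ratio_coef (n : nat) : Rabs (ratio_coef n) <= 1.
Proof. destruct (ratio_coef_bounds n); rewrite Rabs_pos_eq; lra. Qed.

(** The coefficients of index 0 and 1 are those subtracted in [P3] and [h4]. The one of index 2 is
    [beta], and its product with PI / 2 is the left end of the range of [h4]. *)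
Lemma ratio_coef_0 : ratio_coef 0 = 1 / 12.
Proof.
unfold ratio_coef, tail_quotient; rewrite quotient_coef_0.
unfold diff_coef, odd_inv, acoef; simpl; field.
Qed.

Lemma ratio_coef_1 : ratio_coef 1 = 91 / 2880.
Proof.
unfold ratio_coef, tail_quotient; rewrite quotient_coef_S; cbn [sum_f_R0].
rewrite quotient_coef_0; unfold diff_coef, odd_inv, acoef; simpl; field.
Qed.

Lemma ratio_coef_2 : ratio_coef 2 = 871 / 48384.
Proof.
unfold ratio_coef, tail_quotient; rewrite quotient_coef_S; cbn [sum_f_R0].
fold (tail_quotient 1 1); fold ratio_coef; rewrite ratio_coef_0, ratio_coef_1.
unfold diff_coef, odd_inv, acoef; simpl; field.
Qed.

Lemma h1_pseries (r : R) :
  0 < r < 1 -> h1 r = PI / 2 - PI / 2 * PSeries (PS_incr_1 ratio_coef) (r ^ 2).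
Proof.
intros Hr; assert (HPI := PI_RGT_0); assert (HA := arth_gt_0 r Hr).
rewrite h1_ellK, PSeries_incr_1 by trivial.
assert (HE := ellK_expansion 1 0 r ltac:(lra) coef_ratio_1_lt Hr).
rewrite sum_O in HE; fold ratio_coef in HE.
(* The constant coefficients of both series are 1, so the partial sum disappears for [kap = 1]. *)
replace (diff_coef 1 0) with 0 in HE by (unfold diff_coef, odd_inv, acoef; simpl; field).
replace (ellK r) with (PI / 2 * (2 / PI * ellK r)) by (field; lra).
rewrite HE; simpl (2 * 1)%nat; field; lra.
Qed.

Lemma PS_incr_ratio_coef_bounds (n : nat) : 0 <= PS_incr_1 ratio_coef n <= 1.
Proof.
destruct n as [|n]; simpl; [unfold zero; simpl; lra|].
destruct (ratio_coef_bounds n); lra.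
Qed.

Lemma ratio_series_onto :
  strictly_increasing_01 (fun r => PSeries (PS_incr_1 ratio_coef) (r ^ 2)) /\
  maps_01_onto (fun r => PSeries (PS_incr_1 ratio_coef) (r ^ 2)) 0 (1 - 2 / PI).
Proof.
apply (maps_01_onto_pseries _ (PS_incr_1 ratio_coef) 1).
- apply PS_incr_ratio_coef_bounds.
- apply ratio_coef_bounds.
- trivial.
- apply filterlim_ext with (fun r => r ^ 2 * PSeries ratio_coef (r ^ 2)).
  + intros r; now rewrite PSeries_incr_1.
  + replace (1 - 2 / PI) with (1 ^ 2 * (1 - 2 / PI)) by ring.
    apply filterlim_Rmult_fun.
    * apply filterlim_at_left_1_of_ex_derive; auto_derive; trivial.
    * apply filterlim_tail_quotient; [lra|exact coef_ratio_1_lt].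
Qed.

Lemma h4_pseries (r : R) :
  0 < r < 1 -> h4 r = PSeries (PS_scal (PI / 2) (PS_decr_n ratio_coef 2)) (r ^ 2).
Proof.
intros Hr; unfold h4; fold (h1 r); rewrite h1_pseries, PSeries_incr_1, PSeries_scal by trivial.
rewrite (PSeries_decr_n ratio_coef 1).
- simpl sum_f_R0; rewrite ratio_coef_0, ratio_coef_1; simpl; field; lra.
- apply CV_radius_inside, Rabs_lt_CV_radius with 1; [exact Rabs_ratio_coef|].
  apply Rabs_sqr_lt_1; lra.
Qed.

Lemma h4_onto :
  strictly_increasing_01 h4 /\
  maps_01_onto h4 (871 * PI / 96768) (2549 * PI / 5760 - 1).
Proof.
assert (HPI := PI_RGT_0).
assert (Hpos : forall n, 0 < PS_scal (PI / 2) (PS_decr_n ratio_coef 2) n <= PI / 2).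
{ intros n; unfold PS_scal, PS_decr_n, scal; simpl; unfold mult; simpl.
  destruct (ratio_coef_bounds (S (S n))); split; [apply Rmult_lt_0_compat; lra|nra]. }
replace (871 * PI / 96768) with (PS_scal (PI / 2) (PS_decr_n ratio_coef 2) 0).
2:{ unfold PS_scal, PS_decr_n, scal; simpl; unfold mult; simpl; rewrite ratio_coef_2; field. }
apply maps_01_onto_pseries with (PI / 2).
- intros n; destruct (Hpos n); lra.
- apply Hpos.
- exact h4_pseries.
(* The bracket at r = 1 is 1 - 1/12 - 91/2880 = 2549/2880, and [h1] contributes its limit 1. *)
- replace (2549 * PI / 5760 - 1) with
    (1 / 1 ^ 6 * (PI / 2 * (1 - 1 / 12 * 1 ^ 2 - 91 / 2880 * 1 ^ 4) + - 1 * 1)) by field.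
  apply filterlim_ext with (fun r => 1 / r ^ 6 *
     (PI / 2 * (1 - 1 / 12 * r ^ 2 - 91 / 2880 * r ^ 4) + - 1 * h1 r)).
  { intros r; unfold h4; fold (h1 r); ring. }
  apply filterlim_Rmult_fun.
  + apply (filterlim_at_left_1_of_ex_derive (fun r => 1 / r ^ 6)); auto_derive; lra.
  + apply filterlim_Rplus_fun.
    * apply (filterlim_at_left_1_of_ex_derive
        (fun r => PI / 2 * (1 - 1 / 12 * r ^ 2 - 91 / 2880 * r ^ 4))); auto_derive; trivial.
    * apply filterlim_Rmult_fun; [apply filterlim_const|exact filterlim_h1_at_left_1].
Qed.

(** * The functions h2 and h3 *)

(** Here [1 <= n] enters: the ratio equals 3/4 at index 1 and drops strictly below it from index 2
    on. *)
Lemma coef_ratio_SS (n : nat) : (1 <= n)%nat -> coef_ratio (S n) < 3 / 4.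
Proof.
intros Hn; rewrite <- coef_ratio_1.
assert (H1 := coef_ratio_decr n); assert (H2 := coef_ratio_anti 1 n Hn); lra.
Qed.

Lemma h2_quotient (n : nat) (r : R) :
  (1 <= n)%nat -> 0 < r < 1 ->
  h2 n r = PSeries (tail_quotient (3 / 4) (S n)) (r ^ 2) * (arth r / r).
Proof.
intros Hn Hr; unfold h2.
rewrite (ellK_expansion (3 / 4) n r ltac:(lra) (coef_ratio_SS n Hn) Hr).
rewrite (sum_n_m_ext _ (fun k => diff_coef (3 / 4) k * r ^ (2 * k)) 0 n
  (fun k => f_equal (fun c => c * r ^ (2 * k)) (atilde_diff_coef k))).
fold (sum_n (fun k => diff_coef (3 / 4) k * r ^ (2 * k)) n).
rewrite Nat.add_1_r.
assert (Hp : 0 < r ^ (2 * S n)) by (apply pow_lt; lra).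
set (p := r ^ (2 * S n)) in *; field; lra.
Qed.

Lemma h2_maclaurin (n : nat) :
  (1 <= n)%nat -> is_maclaurin_sq_01 (h2 n) (fun k => atilde (n + 1 + k)).
Proof.
intros Hn r Hr; rewrite h2_quotient by trivial.
apply is_pseries_ext with (fun k => diff_coef (3 / 4) (S n + k)).
{ intros k; now rewrite atilde_diff_coef, Nat.add_1_r. }
apply is_pseries_tail; trivial; [lra|now apply coef_ratio_SS].
Qed.

Lemma atilde_bounds (n k : nat) : (1 <= n)%nat -> 0 < atilde (n + 1 + k) <= 1.
Proof.
intros Hn; rewrite atilde_diff_coef, Nat.add_1_r.
apply diff_coef_bounds with (S n); [lra|now apply coef_ratio_SS|lia].
Qed.

Lemma h3_quotient (n : nat) (r : R) :
  (1 <= n)%nat -> 0 < r < 1 ->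
  h3 n r = PSeries (tail_quotient (3 / 4) (S n)) (r ^ 2).
Proof.
intros Hn Hr; unfold h3; rewrite h2_quotient by trivial.
assert (HA := arth_gt_0 r Hr); field; lra.
Qed.

Lemma h3_onto (n : nat) :
  (1 <= n)%nat ->
  strictly_increasing_01 (h3 n) /\
  maps_01_onto (h3 n) (atilde (n + 1)) (3 / 4 - 2 / PI).
Proof.
intros Hn.
assert (Hk : 3 / 4 <= 1) by lra; assert (Hm := coef_ratio_SS n Hn).
assert (Hb := tail_quotient_bounds (3 / 4) (S n) Hk Hm).
replace (atilde (n + 1)) with (tail_quotient (3 / 4) (S n) 0).
2:{ unfold tail_quotient; rewrite quotient_coef_0, atilde_diff_coef; f_equal; lia. }
apply maps_01_onto_pseries with 1.
- intros k; destruct (Hb k); lra.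
- apply Hb.
- intros r Hr; now apply h3_quotient.
- apply filterlim_ext_loc with (2 := filterlim_tail_quotient (3 / 4) n Hk Hm).
  apply filter_imp with (2 := at_left_1_above 0 Rlt_0_1); intros r Hr.
  now rewrite h3_quotient.
Qed.

(** * The elliptic integral in terms of h3 and h4 *)

Lemma h2_h3 (n : nat) (r : R) :
  (1 <= n)%nat -> 0 < r < 1 -> h2 n r = h3 n r * (arth r / r).
Proof. intros Hn Hr; now rewrite h2_quotient, h3_quotient. Qed.

(** The terms of index 0 and 1 leave the sum because [atilde 0 = - (1 / 4)] and [atilde 1 = 0]. The
    sum runs one index further than in [h2]; the added term is compensated, which accounts for the
    summand [- atilde (n + 1)] in [P1] and [P2]. *)
Lemma ellK_h3 (n : nat) (r : R) :
  (1 <= n)%nat -> 0 < r < 1 ->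
  2 / PI * ellK r =
  1 / 4 + 3 / 4 * (arth r / r) - sum_n_m (fun k => atilde k * r ^ (2 * k)) 2 (n + 1)
  + atilde (n + 1) * r ^ (2 * n + 2) - r ^ (2 * n + 2) * (h3 n r * (arth r / r)).
Proof.
intros Hn Hr.
rewrite (ellK_expansion (3 / 4) n r ltac:(lra) (coef_ratio_SS n Hn) Hr) at 1.
rewrite <- h3_quotient by trivial.
rewrite (sum_n_ext _ (fun k => atilde k * r ^ (2 * k)) n
  (fun k => f_equal (fun c => c * r ^ (2 * k)) (eq_sym (atilde_diff_coef k)))).
replace (2 * n + 2)%nat with (2 * S n)%nat by lia.
rewrite Nat.add_1_r, sum_n_Sm by lia.
unfold sum_n; rewrite (sum_Sn_m _ 0) by lia; rewrite (sum_Sn_m _ 1) by lia.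
replace (atilde 0) with (- (1 / 4)) by (unfold atilde, acoef; simpl; field).
replace (atilde 1) with 0 by (unfold atilde, acoef; simpl; field).
change (@plus R_AbelianMonoid) with Rplus; change (2 * 0)%nat with O; ring.
Qed.

Lemma ellK_h4 (r : R) :
  0 < r < 1 ->
  2 / PI * ellK r = (P3 r - 2 / PI * h4 r * r ^ 6) * (arth r / r).
Proof.
intros Hr; assert (HPI := PI_RGT_0); assert (HA := arth_gt_0 r Hr).
unfold h4, P3; field; repeat split; lra.
Qed.

Lemma ellK_h3_1 (r : R) :
  0 < r < 1 ->
  2 / PI * ellK r = 1 / 4 + 3 / 4 * (1 - 4 / 3 * h3 1 r * r ^ 4) * (arth r / r).
Proof.
intros Hr; rewrite (ellK_h3 1 r (le_n 1) Hr) at 1.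
(* For n = 1 the sum is the single term [atilde 2 * r ^ 4], which the compensating term cancels. *)
simpl (1 + 1)%nat; simpl (2 * 1 + 2)%nat; rewrite sum_n_n; simpl (2 * 2)%nat; field; lra.
Qed.

(** * Shape of h1 and limits of h2 *)

Lemma h1_properties :
  strictly_decreasing_01 h1 /\ concave_01 h1 /\ maps_01_onto h1 1 (PI / 2).
Proof.
assert (HPI := PI_RGT_0); destruct ratio_series_onto as [H1 O1].
split; [|split].
- intros x y Hx Hxy Hy; rewrite !h1_pseries by lra.
  assert (H := H1 x y Hx Hxy Hy); cbv beta in H.
  apply Rplus_lt_compat_l, Ropp_lt_contravar, Rmult_lt_compat_l; lra.
- intros x y t Hx Hy Ht.
  assert (Hz : 0 < t * x + (1 - t) * y < 1).
  { assert (0 <= t * (1 - x)) by (apply Rmult_le_pos; lra).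
    assert (0 <= (1 - t) * (1 - y)) by (apply Rmult_le_pos; lra).
    assert (0 <= t * x) by (apply Rmult_le_pos; lra).
    assert (0 <= (1 - t) * y) by (apply Rmult_le_pos; lra).
    (* Strict bounds need a positive weight: [1 - t] when t <= 1/2, and [t] otherwise. *)
    destruct (Rle_lt_dec t (/ 2)); split; nra. }
  rewrite !h1_pseries by trivial.
  assert (H := PSeries_sqr_convex _ 1 x y t PS_incr_ratio_coef_bounds Hx Hy Ht).
  apply Rmult_le_compat_l with (r := PI / 2) in H; lra.
- apply (maps_01_onto_ext
    (fun r => PI / 2 - PI / 2 * PSeries (PS_incr_1 ratio_coef) (r ^ 2)) h1).
  + exact h1_pseries.
  + assert (H := maps_01_onto_reflect _ _ _ (PI / 2)
      (maps_01_onto_scal _ _ _ (PI / 2) ltac:(lra) O1)).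
    replace (PI / 2 - PI / 2 * (1 - 2 / PI)) with 1 in H by (field; lra).
    now rewrite Rmult_0_r, Rminus_0_r in H.
Qed.

Lemma filterlim_h2_at_right_0 (n : nat) :
  (1 <= n)%nat -> filterlim (h2 n) (at_right 0) (locally (atilde (n + 1))).
Proof.
intros Hn.
apply filterlim_ext_loc with (fun r => PSeries (fun k => atilde (n + 1 + k)) (r ^ 2)).
- apply filter_imp with (2 := at_right_0_below 1 Rlt_0_1); intros r Hr.
  apply is_pseries_unique; now apply h2_maclaurin.
- replace (atilde (n + 1)) with (atilde (n + 1 + 0)) by (f_equal; lia).
  apply (filterlim_at_right_0_PSeries_sqr (fun k => atilde (n + 1 + k)) 1).
  intros k; destruct (atilde_bounds n k Hn); rewrite Rabs_pos_eq; lra.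
Qed.

(** [h2] is [h3], which stays above the positive constant [atilde (n + 1)], times arth r / r, which
    diverges. *)
Lemma filterlim_h2_at_left_1 (n : nat) :
  (1 <= n)%nat -> filterlim (h2 n) (at_left 1) (Rbar_locally p_infty).
Proof.
intros Hn; assert (Ha := atilde_bounds n 0 Hn); rewrite Nat.add_0_r in Ha.
apply filterlim_ge_p_infty with (fun r => atilde (n + 1) * (arth r / r)).
- apply filter_imp with (2 := at_left_1_above 0 Rlt_0_1); intros r Hr.
  rewrite h2_h3 by trivial.
  assert (HA := arth_div_gt_0 r Hr).
  assert (H := maps_01_onto_bounds _ _ _ r (proj2 (h3_onto n Hn)) Hr).
  apply Rmult_le_compat_r; lra.
- eapply filterlim_comp; [exact filterlim_arth_div|].
  replace p_infty with (Rbar_mult (atilde (n + 1)) p_infty) at 2.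
  + apply filterlim_Rbar_mult_l.
  + now apply is_Rbar_mult_unique, is_Rbar_mult_sym, is_Rbar_mult_p_infty_pos.
Qed.

(** * The inequalities and their best constants *)

Lemma bound_i_valid (n : nat) :
  (1 <= n)%nat ->
  lower_bound_01 (bound_i n (P1 n)) /\ upper_bound_01 (bound_i n (P2 n)).
Proof.
intros Hn; assert (HPI := PI_RGT_0).
assert (H : forall r, 0 < r < 1 -> 0 < r ^ (2 * n + 2) /\ 0 < arth r / r /\
              atilde (n + 1) < h3 n r < 3 / 4 - 2 / PI).
{ intros r Hr; split; [apply pow_lt; lra|split; [now apply arth_div_gt_0|]].
  exact (maps_01_onto_bounds _ _ _ r (proj2 (h3_onto n Hn)) Hr). }
split; intros r Hr; destruct (H r Hr) as [Hp [HA [Hlo Hhi]]];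
  rewrite (ellK_h3 n r Hn Hr); unfold bound_i, P1, P2;
  replace (3 * arth r / (4 * r)) with (3 / 4 * (arth r / r)) by (field; lra);
  set (p := r ^ (2 * n + 2)) in *; set (A := arth r / r) in *.
- replace ((3 * PI - 8) / (4 * PI)) with (3 / 4 - 2 / PI) by (field; lra).
  assert (p * (h3 n r * A) < p * ((3 / 4 - 2 / PI) * A)); [|lra].
  apply Rmult_lt_compat_l, Rmult_lt_compat_r; trivial.
- assert (p * (atilde (n + 1) * A) < p * (h3 n r * A)); [|lra].
  apply Rmult_lt_compat_l, Rmult_lt_compat_r; trivial.
Qed.

(** At each [r] the function (2/PI) K is the member of the decreasing family [g] with parameter
    [u r]. A constant is therefore valid on one side exactly when it bounds all values of [u], and
    the ends of the range of [u] are optimal. A constant beyond an end fails at a point where [u]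
    passes it. *)
Lemma best_constants (g : R -> R -> R) (u : R -> R) (a b : R) :
  (forall c d r, 0 < r < 1 -> c < d -> g d r < g c r) ->
  (forall r, 0 < r < 1 -> 2 / PI * ellK r = g (u r) r) ->
  maps_01_onto u a b ->
  (lower_bound_01 (g b) /\ upper_bound_01 (g a)) /\
  (forall c, c < b -> ~ lower_bound_01 (g c)) /\
  (forall c, a < c -> ~ upper_bound_01 (g c)).
Proof.
intros Hg HK Hu; repeat split.
- intros r Hr; rewrite HK by trivial; apply Hg; trivial.
  now apply (maps_01_onto_bounds u a b).
- intros r Hr; rewrite HK by trivial; apply Hg; trivial.
  now apply (maps_01_onto_bounds u a b).
- intros c Hc H; destruct (maps_01_onto_above u a b c Hu Hc) as [r [Hr Hcr]].
  specialize (H r Hr); rewrite HK in H by trivial.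
  assert (H' := Hg _ _ r Hr Hcr); lra.
- intros c Hc H; destruct (maps_01_onto_below u a b c Hu Hc) as [r [Hr Hcr]].
  specialize (H r Hr); rewrite HK in H by trivial.
  assert (H' := Hg _ _ r Hr Hcr); lra.
Qed.

Lemma bound_ii_best :
  (lower_bound_01 (bound_ii alpha) /\ upper_bound_01 (bound_ii beta)) /\
  (forall c : R, c < alpha -> ~ lower_bound_01 (bound_ii c)) /\
  (forall c : R, beta < c -> ~ upper_bound_01 (bound_ii c)).
Proof.
assert (HPI := PI_RGT_0).
apply best_constants with (u := fun r => 2 / PI * h4 r).
- intros c d r Hr Hcd; unfold bound_ii; apply Rmult_lt_compat_r; [now apply arth_div_gt_0|].
  assert (0 < r ^ 6) by (apply pow_lt; lra); nra.
- exact ellK_h4.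
- replace alpha with (2 / PI * (2549 * PI / 5760 - 1)) by (unfold alpha; field; lra).
  replace beta with (2 / PI * (871 * PI / 96768)) by (unfold beta; field; lra).
  apply maps_01_onto_scal; [apply Rdiv_lt_0_compat; lra|exact (proj2 h4_onto)].
Qed.

Lemma bound_iii_best :
  (lower_bound_01 (bound_iii delta) /\ upper_bound_01 (bound_iii eta)) /\
  (forall c : R, c < delta -> ~ lower_bound_01 (bound_iii c)) /\
  (forall c : R, eta < c -> ~ upper_bound_01 (bound_iii c)).
Proof.
assert (HPI := PI_RGT_0).
apply best_constants with (u := fun r => 4 / 3 * h3 1 r).
- intros c d r Hr Hcd; unfold bound_iii.
  apply Rplus_lt_compat_l, Rmult_lt_compat_r; [now apply arth_div_gt_0|].
  assert (0 < r ^ 4) by (apply pow_lt; lra); nra.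
- exact ellK_h3_1.
(* These are the ends of the range of [h3 1] times 4/3, the factor that undoes the 3/4 in
   [bound_iii]. For [eta], atilde_2 = 3/20 - 9/64 = 3/320. *)
- replace delta with (4 / 3 * (3 / 4 - 2 / PI)) by (unfold delta; field; lra).
  replace eta with (4 / 3 * atilde (1 + 1))
    by (unfold eta, atilde, acoef; simpl; field).
  apply maps_01_onto_scal; [lra|exact (proj2 (h3_onto 1 (le_n 1)))].
Qed.

Theorem theorem1p8 :
  (* (1) *)
  (strictly_decreasing_01 h1 /\ concave_01 h1 /\ maps_01_onto h1 1 (PI / 2)) /\
  (* (2) *)
  (forall n : nat, (1 <= n)%nat ->
     (exists c : nat -> R,
        is_maclaurin_sq_01 (h2 n) c /\ forall k : nat, 0 < c k) /\
     strictly_absolutely_monotone_01 (h2 n) /\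
     filterlim (h2 n) (at_right 0) (locally (atilde (n + 1))) /\
     0 < atilde (n + 1) /\
     filterlim (h2 n) (at_left 1) (Rbar_locally p_infty)) /\
  (* (3) *)
  (forall n : nat, (1 <= n)%nat ->
     strictly_increasing_01 (h3 n) /\
     maps_01_onto (h3 n) (atilde (n + 1)) (3 / 4 - 2 / PI)) /\
  (* (4) *)
  (strictly_increasing_01 h4 /\
   maps_01_onto h4 (871 * PI / 96768) (2549 * PI / 5760 - 1)) /\
  (* (5) *)
  (forall n : nat, (1 <= n)%nat ->
     lower_bound_01 (bound_i n (P1 n)) /\ upper_bound_01 (bound_i n (P2 n))) /\
  (lower_bound_01 (bound_ii alpha) /\ upper_bound_01 (bound_ii beta)) /\
  (lower_bound_01 (bound_iii delta) /\ upper_bound_01 (bound_iii eta)) /\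
  (forall c : R, c < alpha -> ~ lower_bound_01 (bound_ii c)) /\
  (forall c : R, beta < c -> ~ upper_bound_01 (bound_ii c)) /\
  (forall c : R, c < delta -> ~ lower_bound_01 (bound_iii c)) /\
  (forall c : R, eta < c -> ~ upper_bound_01 (bound_iii c)).
Proof.
destruct bound_ii_best as [Hii [Hii1 Hii2]]; destruct bound_iii_best as [Hiii [Hiii1 Hiii2]].
split; [exact h1_properties|].
split.
{ intros n Hn; split; [|split; [|split; [|split]]].
  - exists (fun k => atilde (n + 1 + k)); split; [now apply h2_maclaurin|].
    intros k; now apply atilde_bounds.
  - apply strictly_absolutely_monotone_pseries with (fun k => atilde (n + 1 + k)) 1.
    + intros k; now apply atilde_bounds.
    + now apply h2_maclaurin.
  - now apply filterlim_h2_at_right_0.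
  - rewrite <- (Nat.add_0_r (n + 1)); now apply atilde_bounds.
  - now apply filterlim_h2_at_left_1. }
split; [exact h3_onto|].
split; [exact h4_onto|].
split; [exact bound_i_valid|].
repeat (split; trivial).
Qed.
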